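(* Let $M$ be a connected simple binary matroid. Then $M$ has neither $M(C_4)$ nor $M(K_4\backslash e)$ as an induced minor if and only if $M$ is a binary projective geometry, a binary projective geometry with a single point deleted, or the cycle matroid of a complete graph.
   Context: All matroids are simple; every contraction is immediately followed by simplification. An induced minor of $M$ is a matroid obtained from $M$ by a sequence of restrictions to flats and contractions (each contraction followed by simplification). $C_4$ is the 4-cycle graph and $K_4\backslash e$ is $K_4$ with one edge deleted. *)

(* Defs.v *)
From HB Require Import structures.
From mathcomp Require Import all_boot all_order all_algebra.

Set Implicit Arguments.
Unset Strict Implicit.
Unset Printing Implicit Defensive.

Import GRing.Theory.
Local Open Scope ring_scope.

(* The ground set is a subset of a finite type of labels, so that the minors  *)
(* of a matroid live over the same type of labels as the matroid itself.      *)
Record matroid (T : finType) := Matroid {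
  ground : {set T};
  indeps : {set {set T}};
  indep_sub_ground : forall I, I \in indeps -> I \subset ground;
  indep0 : set0 \in indeps;
  indepS : forall I J : {set T},
    J \in indeps -> I \subset J -> I \in indeps;
  indep_aug : forall I J : {set T}, I \in indeps -> J \in indeps ->
    (#|I| < #|J|)%N -> exists2 x, x \in J :\: I & x |: I \in indeps
}.

Section MatroidTheory.

Variables (T : finType) (M : matroid T).
Implicit Types (x y : T) (A B C F I S X : {set T}).

Definition rank A : nat := \max_(I in indeps M | I \subset A) #|I|.

Definition basis X B : bool :=
  maxset (fun I => (I \in indeps M) && (I \subset X)) B.

Definition circuit C : bool :=
  [&& C \subset ground M, C \notin indeps M &
      [forall D : {set T}, (D \proper C) ==> (D \in indeps M)]].

Definition closure A : {set T} :=
  [set x in ground M | rank (x |: A) == rank A].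

Definition flat F : bool := (F \subset ground M) && (closure F == F).

Definition loop x : bool := circuit [set x].

Definition parallel x y : bool := (x != y) && circuit [set x; y].

Definition simple_matroid : Prop :=
  forall x y, ~~ loop x /\ ~~ parallel x y.

Definition connected_matroid : Prop :=
  forall x y, x \in ground M -> y \in ground M -> x != y ->
  exists2 C, circuit C & (x \in C) && (y \in C).

(* S consists of exactly one element of each parallel class: M restricted to  *)
(* S is then a simplification of M.                                           *)
Definition simplifying_set S : Prop :=
  [/\ S \subset ground M,
      forall x, x \in S -> ~~ loop x &
      forall x, x \in ground M -> ~~ loop x ->
        #|[set y in S | (y == x) || parallel x y]| = 1%N].

Lemma basis_indep X B : basis X B -> B \in indeps M.
Proof. by case/maxsetP => /andP[]. Qed.

Lemma basis_sub X B : basis X B -> B \subset X.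
Proof. by case/maxsetP => /andP[]. Qed.

Lemma basis_max X B x : basis X B -> x \in X -> x |: B \in indeps M -> x \in B.
Proof.
case/maxsetP => /andP[BI BX] Bmax xX xBI.
by rewrite -(Bmax (x |: B)) ?setU11 ?subsetUr // xBI subUset sub1set xX.
Qed.

Lemma basis_exists X : exists B, basis X B.
Proof.
have [|B Bmax _] := @maxset_exists T
  (fun I => (I \in indeps M) && (I \subset X)) set0.
  by rewrite indep0 sub0set.
by exists B.
Qed.

Lemma basis_leq X B1 B2 : basis X B1 -> basis X B2 -> (#|B2| <= #|B1|)%N.
Proof.
move=> b1 b2; rewrite leqNgt; apply/negP => lt12.
have [x] := indep_aug (basis_indep b1) (basis_indep b2) lt12.
rewrite inE => /andP[xB1 xB2] xI; case/negP: xB1.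
exact: basis_max b1 (subsetP (basis_sub b2) _ xB2) xI.
Qed.

Section Restriction.
Variable A : {set T}.

Let r_ground := ground M :&: A.
Let r_indeps := [set I in indeps M | I \subset A].

Fact restrict_sub I : I \in r_indeps -> I \subset r_ground.
Proof.
by rewrite inE => /andP[/indep_sub_ground IM IA]; rewrite subsetI IM.
Qed.

Fact restrict0 : set0 \in r_indeps.
Proof. by rewrite inE indep0 sub0set. Qed.

Fact restrictS I (J : {set T}) : J \in r_indeps -> I \subset J -> I \in r_indeps.
Proof.
rewrite !inE => /andP[JI JA] IJ.
by rewrite (indepS JI IJ) (subset_trans IJ JA).
Qed.

Fact restrict_aug I (J : {set T}) : I \in r_indeps -> J \in r_indeps ->
  (#|I| < #|J|)%N -> exists2 x, x \in J :\: I & x |: I \in r_indeps.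
Proof.
rewrite !inE => /andP[II IA] /andP[JI JA] ltIJ.
have [x xJI xI] := indep_aug II JI ltIJ; exists x => //.
rewrite inE xI subUset sub1set IA andbT (subsetP JA) //.
by case/setDP: xJI.
Qed.

Definition restrict : matroid T :=
  Matroid restrict_sub restrict0 restrictS restrict_aug.

End Restriction.

Definition delete A : matroid T := restrict (~: A).

Section Contraction.
Variable X : {set T}.

Let c_ground := ground M :\: X.
Let c_indeps := [set I : {set T} | (I \subset ground M :\: X) &&
  [exists B, basis X B && (I :|: B \in indeps M)]].

Fact contract_sub I : I \in c_indeps -> I \subset c_ground.
Proof. by rewrite inE => /andP[]. Qed.

Fact contract0 : set0 \in c_indeps.
Proof.
rewrite inE sub0set; have [B bB] := basis_exists X.
by apply/existsP; exists B; rewrite bB set0U (basis_indep bB).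
Qed.

Fact contractS I (J : {set T}) : J \in c_indeps -> I \subset J -> I \in c_indeps.
Proof.
rewrite !inE => /andP[JE /existsP[B /andP[bB JB]]] IJ.
rewrite (subset_trans IJ JE); apply/existsP; exists B.
by rewrite bB (indepS JB) ?setSU.
Qed.

Fact contract_aug I (J : {set T}) : I \in c_indeps -> J \in c_indeps ->
  (#|I| < #|J|)%N -> exists2 x, x \in J :\: I & x |: I \in c_indeps.
Proof.
rewrite !inE => /andP[IE /existsP[B /andP[bB IB]]].
case/andP=> JE /existsP[B' /andP[bB' JB']] ltIJ.
have dis (K D : {set T}) : K \subset ground M :\: X -> basis X D ->
    #|K :|: D| = (#|K| + #|D|)%N.
  move=> KE bD; rewrite cardsU [K :&: D](_ : _ = set0) ?cards0 ?subn0 //.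
  apply/setP => z; rewrite !inE; apply/negP => /andP[/(subsetP KE)].
  by rewrite inE => /andP[/negP zX _] /(subsetP (basis_sub bD)).
have lt : (#|I :|: B| < #|J :|: B'|)%N.
  rewrite !dis // (leq_trans (n := (#|J| + #|B|)%N)) ?ltn_add2r //.
  by rewrite leq_add2l (basis_leq bB' bB).
have [x] := indep_aug IB JB' lt; rewrite !inE negb_or.
case/andP=> /andP[xI xB] xJB xind.
have xX : x \notin X.
  apply: contra xB => xX; apply: basis_max bB xX _.
  by apply: indepS xind _; rewrite setUS // subsetUr.
have xJ : x \in J.
  by case/orP: xJB => // /(subsetP (basis_sub bB')); rewrite (negPf xX).
exists x; first by rewrite inE xI.
rewrite inE subUset sub1set (subsetP JE) // IE.
by apply/existsP; exists B; rewrite bB -setUA.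
Qed.

Definition contract : matroid T :=
  Matroid contract_sub contract0 contractS contract_aug.

End Contraction.

End MatroidTheory.

Definition isomorphic (T U : finType) (M : matroid T) (N : matroid U) : Prop :=
  exists2 f : {x | x \in ground M} -> {y | y \in ground N},
    bijective f &
    forall I : {set {x | x \in ground M}},
      (val @: I \in indeps M) = (val @: (f @: I) \in indeps N).

Inductive induced_minor (T : finType) (M : matroid T) : matroid T -> Prop :=
| induced_minor_refl : induced_minor M M
| induced_minor_flat N (F : {set T}) :
    induced_minor M N -> flat N F -> induced_minor M (restrict N F)
| induced_minor_contract N (X S : {set T}) :
    induced_minor M N -> X \subset ground N ->
    simplifying_set (contract N X) S ->
    induced_minor M (restrict (contract N X) S).

Definition has_induced_minor (T U : finType) (M : matroid T) (N : matroid U) :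
  Prop := exists2 N', induced_minor M N' & isomorphic N' N.

Section VectorMatroid.

Variables (K : fieldType) (V : vectType K) (T : finType).
Variables (E : {set T}) (v : T -> V).
Implicit Types I J : {set T}.

(* `free` is a property of families: it fails when v repeats a vector on I.   *)
Definition vec_indep I : bool := free [seq v x | x <- enum I].

Let v_indeps := [set I : {set T} | (I \subset E) && vec_indep I].

Lemma vec_indepU1 x I : x \notin I ->
  vec_indep (x |: I) = (v x \notin <<[seq v y | y <- enum I]>>%VS) && vec_indep I.
Proof.
move=> xI; rewrite /vec_indep -free_cons -map_cons.
apply/perm_free/perm_map/uniq_perm; rewrite ?enum_uniq //=.
  by rewrite mem_enum xI enum_uniq.
by move=> y; rewrite !inE !mem_enum !inE.
Qed.

Lemma vec_indepS I J : vec_indep J -> I \subset J -> vec_indep I.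
Proof.
move=> fJ IJ; apply: (catl_free (Y := [seq v x | x <- enum (J :\: I)])).
rewrite -map_cat; move: fJ; rewrite /vec_indep.
rewrite (perm_free (Y := [seq v x | x <- enum I ++ enum (J :\: I)])) //.
apply/perm_map/uniq_perm; rewrite ?enum_uniq //.
  rewrite cat_uniq !enum_uniq andbT; apply/hasPn => x.
  by rewrite /= !mem_enum inE => /andP[].
move=> x; rewrite mem_cat !mem_enum !inE.
by have [/(subsetP IJ)|] := boolP (x \in I).
Qed.

Lemma vec_indep_aug I J : vec_indep I -> vec_indep J -> (#|I| < #|J|)%N ->
  exists2 x, x \in J :\: I & vec_indep (x |: I).
Proof.
move=> fI fJ ltIJ.
have [/existsP[x /andP[xJI xI]]|/existsPn nx] :=
  boolP [exists x, (x \in J :\: I) && vec_indep (x |: I)]; first by exists x.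
have sub : (<<[seq v y | y <- enum J]>> <= <<[seq v y | y <- enum I]>>)%VS.
  apply/span_subvP => _ /mapP[x + ->]; rewrite mem_enum => xJ.
  have [xI|xI] := boolP (x \in I).
    by apply/memv_span/map_f; rewrite mem_enum.
  by move: (nx x); rewrite in_setD xI xJ vec_indepU1 // fI /= andbT negbK.
move: (dimvS sub); rewrite (eqP fI) (eqP fJ) !size_map -!cardE.
by rewrite leqNgt ltIJ.
Qed.

Fact vector_sub I : I \in v_indeps -> I \subset E.
Proof. by rewrite inE => /andP[]. Qed.

Fact vector0 : set0 \in v_indeps.
Proof. by rewrite inE sub0set /vec_indep enum_set0 nil_free. Qed.

Fact vectorS I J : J \in v_indeps -> I \subset J -> I \in v_indeps.
Proof.
rewrite !inE => /andP[JE fJ] IJ.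
by rewrite (subset_trans IJ JE) (vec_indepS fJ IJ).
Qed.

Fact vector_aug I J : I \in v_indeps -> J \in v_indeps ->
  (#|I| < #|J|)%N -> exists2 x, x \in J :\: I & x |: I \in v_indeps.
Proof.
rewrite !inE => /andP[IE fI] /andP[JE fJ] ltIJ.
have [x xJI fx] := vec_indep_aug fI fJ ltIJ; exists x => //.
rewrite inE fx subUset sub1set IE !andbT (subsetP JE) //.
by case/setDP: xJI.
Qed.

Definition vector_matroid : matroid T :=
  Matroid vector_sub vector0 vectorS vector_aug.

End VectorMatroid.

Definition binary_matroid (T : finType) (M : matroid T) : Prop :=
  exists (m n : nat) (A : 'M['F_2]_(m, n)),
    isomorphic M (vector_matroid [set: 'I_n] (fun j => col j A)).

(* PG(n-1, 2), of rank n: over 'F_2 every line through the origin contains    *)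
(* exactly one nonzero vector, so that points are nonzero vectors.            *)
Definition binary_pg (n : nat) : matroid 'rV['F_2]_n :=
  vector_matroid [set p : 'rV['F_2]_n | p != 0] (@id 'rV['F_2]_n).

Record sgraph (V : finType) := SGraph {
  adj : rel V;
  adj_sym : symmetric adj;
  adj_irrefl : irreflexive adj
}.

Definition edges (V : finType) (G : sgraph V) : {set {set V}} :=
  [set [set p.1; p.2] | p : V * V & adj G p.1 p.2].

Definition edge_rel (V : finType) (I : {set {set V}}) : rel V :=
  fun x y => [set x; y] \in I.

(* The vertices of a cycle are at least three and pairwise distinct, hence at *)
(* most #|V|.                                                                 *)
Definition acyclic (V : finType) (I : {set {set V}}) : bool :=
  [forall n : 'I_#|V|.+1, forall c : n.-tuple V,
    (2 < n)%N ==> ~~ ucycleb (edge_rel I) c].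

Section CycleMatroid.

Local Notation F2 := (GRing.regular 'F_2).

Variable V : finType.
Implicit Types (x y : V) (c p : seq V) (e : {set V}) (I J : {set {set V}}).

Lemma acyclicP I : reflect
  (forall c, (2 < size c)%N -> ~ ucycle (edge_rel I) c) (acyclic I).
Proof.
apply: (iffP idP) => [/forallP aI c c2 cI|aI].
  have cV : (size c < #|V|.+1)%N.
    by have /andP[_ /card_uniqP <-] := cI; rewrite ltnS max_card.
  have /forallP/(_ (in_tuple c)) := aI (Ordinal cV).
  by rewrite /= c2 => /negP.
apply/forallP => n; apply/forallP => c; apply/implyP => n2.
by apply/negP => /aI; apply; rewrite size_tuple.
Qed.

Lemma edge_rel_sym I : symmetric (edge_rel I).
Proof. by move=> x y; rewrite /edge_rel setUC. Qed.

(* Characteristic vectors, over the field of two elements.                    *)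
Definition edge_vec e : {ffun V -> F2} := [ffun z => (z \in e)%:R].

Let F2_pchar : 2%N \in [pchar 'F_2] := pchar_Fp (isT : prime 2).

Let dvec x : {ffun V -> F2} := [ffun z => (z == x)%:R].

Let addvv (u : {ffun V -> F2}) : u + u = 0.
Proof. by apply/ffunP => z; rewrite !ffunE (addrr_pchar2 F2_pchar). Qed.

Let edge_vecE x y : x != y -> edge_vec [set x; y] = dvec x + dvec y.
Proof.
move=> xy; apply/ffunP => z; rewrite !ffunE !inE.
by have [->|] := eqVneq z x; rewrite ?(negPf xy) ?addr0 ?add0r.
Qed.

Lemma connect_span I x y :
  (forall z, [set z; z] \notin I) -> connect (edge_rel I) x y ->
  dvec x + dvec y \in <<[seq edge_vec e | e <- enum I]>>%VS.
Proof.
move=> I1 /connectP[p + ->] {y}; elim: p x => [|z p IH] x /=.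
  by rewrite addvv mem0v.
case/andP=> xz /IH zI.
have -> : dvec x + dvec (last z p) =
    (dvec x + dvec z) + (dvec z + dvec (last z p)).
  by rewrite addrA -(addrA (dvec x)) addvv addr0.
rewrite memvD // -edge_vecE; last first.
  by apply: contraTneq xz => ->; apply: I1.
by apply/memv_span/map_f; rewrite mem_enum.
Qed.

Lemma span_connect I x y :
  (forall e, e \in I -> exists u w, u != w /\ e = [set u; w]) ->
  x != y -> edge_vec [set x; y] \in <<[seq edge_vec e | e <- enum I]>>%VS ->
  connect (edge_rel I) x y.
Proof.
move=> I2 xy; apply: contraLR => nxy.
pose phi (u : {ffun V -> F2}) : F2 :=
  \sum_(z | connect (edge_rel I) x z) u z.
have phi_lin : linear phi.
  move=> a u w; rewrite /phi scaler_sumr -big_split /=.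
  by apply: eq_bigr => z _; rewrite !ffunE.
pose phiM := GRing.isLinear.Build _ _ _ _ phi phi_lin.
pose phiL : {linear {ffun V -> F2} -> F2} := HB.pack phi phiM.
have phi_d z : phi (dvec z) = (connect (edge_rel I) x z)%:R.
  rewrite /phi; have [xz|xz] := boolP (connect _ x z).
    rewrite (bigD1 z) //= ffunE eqxx big1 ?addr0 // => t /andP[_ tz].
    by rewrite ffunE (negPf tz).
  by rewrite big1 // => t xt; rewrite ffunE; case: eqP xz => // <-; rewrite xt.
have phiD u w : phi (u + w) = phi u + phi w := raddfD phiL u w.
apply/negP => xyI.
have sub : (<<[seq edge_vec e | e <- enum I]>> <= lker (linfun phiL))%VS.
  apply/span_subvP => _ /mapP[e + ->]; rewrite mem_enum => eI.
  have [u [w [uw ee]]] := I2 e eI; rewrite memv_ker lfunE /= ee edge_vecE //.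
  rewrite phiD !phi_d; have -> : connect (edge_rel I) x u = connect (edge_rel I) x w.
    have uwc : connect (edge_rel I) u w by apply: connect1; rewrite /edge_rel -ee.
    have wuc : connect (edge_rel I) w u.
      by apply: connect1; rewrite edge_rel_sym /edge_rel -ee.
    by apply/idP/idP => h; apply: connect_trans h _.
  by rewrite (addrr_pchar2 F2_pchar).
have := subvP sub _ xyI; rewrite memv_ker lfunE /= edge_vecE // phiD !phi_d.
by rewrite connect0 (negPf nxy) addr0 oner_eq0.
Qed.

Lemma acyclic_free I :
  (forall e, e \in I -> exists u w, u != w /\ e = [set u; w]) ->
  acyclic I = vec_indep edge_vec I.
Proof.
move=> I2; apply/idP/idP => [|fI].
  have [n] := ubnP #|I|; elim: n I I2 => // n IH I I2 ltIn aI.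
  have [->|[e eI]] := set_0Vmem I.
    by rewrite /vec_indep enum_set0 nil_free.
  rewrite -(setD1K eI) vec_indepU1 ?setD11 //.
  have D2 e' : e' \in I :\ e -> exists u w, u != w /\ e' = [set u; w].
    by move=> /setD1P[_ /I2].
  apply/andP; split; last first.
    apply: IH => //; first by move: ltIn; rewrite (cardsD1 e) eI.
    apply/acyclicP => c c2 /andP[cc uc]; apply: (acyclicP _ aI c c2).
    rewrite /ucycle uc andbT; apply: sub_cycle cc => x y.
    by rewrite /edge_rel => /setD1P[].
  have [x [y [xy ee]]] := I2 e eI.
  rewrite [X in edge_vec X]ee.
  apply/negP => /(span_connect D2 xy) /connectP[p0 pp yl].
  case/shortenP: pp yl => p pp up _ yl {p0}.
  apply: (acyclicP _ aI (x :: p)).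
    case: p pp up yl => [|z [|//]] /=; first by move=> _ _ yx; rewrite yx eqxx in xy.
    by rewrite andbT /edge_rel => + _ yz; rewrite -yz -ee setD11.
  rewrite /ucycle up andbT /= rcons_path -yl edge_rel_sym /edge_rel -ee eI andbT.
  by apply: sub_path pp => u w; rewrite /edge_rel => /setD1P[].
apply/acyclicP => -[|a [|b [|d p]]] // _; rewrite /ucycle => /andP[].
set q := d :: p; rewrite (cycle_path a) /= -/q.
rewrite -[last d p]/(last b q) => /and3P[laI abI pI] /and3P[aq bq uq].
have ab : a != b by apply: contra aq => /eqP->; rewrite mem_head.
have aq' : a \notin q by apply: contra aq => aq; rewrite in_cons aq orbT.
pose J := I :\ [set a; b].
have I1 z : [set z; z] \notin I.
  apply/negP => /I2[u [w [uw /setP e]]]; move: (e u) (e w) uw.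
  by rewrite !inE !eqxx !orbb orbT => /eqP-> /eqP->; rewrite eqxx.
have J1 z : [set z; z] \notin J by rewrite inE negb_and I1 orbT.
have cJ : connect (edge_rel J) b a.
  have la : a != last b q.
    by apply: contra aq => /eqP->; exact: mem_last.
  have lb : b != last b q.
    by apply: contra bq => /eqP->; exact: (mem_last d p).
  apply: (@connect_trans _ _ (last b q)); last first.
    apply: connect1; rewrite /edge_rel inE [_ \in I]laI andbT inE.
    apply: contra_neq la => /setP/(_ (last b q)).
    rewrite !inE eqxx /= => /esym/orP[/eqP->//|]; by rewrite eq_sym (negPf lb).
  apply/connectP; exists q => //.
  apply: (@sub_in_path _ (predC1 a) _ _ _ b q) pI; last first.
    by apply/allP => z zq; apply: contraNneq aq => <-.
  move=> u w /= ua wa uw; rewrite /edge_rel inE [_ \in I]uw andbT inE.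
  apply: contraNneq ua => /setP/(_ a); rewrite !inE eqxx /=.
  by rewrite eq_sym (eq_sym a w) (negPf wa) orbF.
have abJ : edge_vec [set a; b] \in <<[seq edge_vec e | e <- enum J]>>%VS.
  by rewrite edge_vecE // addrC; apply: connect_span.
by move: fI; rewrite -(setD1K abI) vec_indepU1 ?setD11 // -/J abJ.
Qed.

Variable G : sgraph V.

Let g_indeps := [set I : {set {set V}} | (I \subset edges G) && acyclic I].

Fact edgesP e : e \in edges G -> exists u w, u != w /\ e = [set u; w].
Proof.
case/imsetP => -[u w]; rewrite inE /= => uw ->; exists u, w; split=> //.
by apply: contraTneq uw => ->; rewrite adj_irrefl.
Qed.

Fact g_indepsE : g_indeps = indeps (vector_matroid (edges G) edge_vec).
Proof.
apply/setP => I; rewrite !inE; have [IE|//] := boolP (I \subset edges G).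
by rewrite acyclic_free // => e /(subsetP IE)/edgesP.
Qed.

Fact cycle_sub I : I \in g_indeps -> I \subset edges G.
Proof. by rewrite inE => /andP[]. Qed.

Fact cycle0 : set0 \in g_indeps.
Proof. by rewrite g_indepsE indep0. Qed.

Fact cycleS I J : J \in g_indeps -> I \subset J -> I \in g_indeps.
Proof. by rewrite g_indepsE; apply: indepS. Qed.

Fact cycle_aug I J : I \in g_indeps -> J \in g_indeps ->
  (#|I| < #|J|)%N -> exists2 e, e \in J :\: I & e |: I \in g_indeps.
Proof. by rewrite g_indepsE; apply: indep_aug. Qed.

Definition cycle_matroid : matroid {set V} :=
  Matroid cycle_sub cycle0 cycleS cycle_aug.

End CycleMatroid.

Section Graphs.

Definition cycle_adj n : rel 'I_n := fun x y =>
  (x != y) && ((y == ordS x) || (x == ordS y)).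

Fact cycle_adj_sym n : symmetric (@cycle_adj n).
Proof. by move=> x y; rewrite /cycle_adj eq_sym orbC. Qed.

Fact cycle_adj_irrefl n : irreflexive (@cycle_adj n).
Proof. by move=> x; rewrite /cycle_adj eqxx. Qed.

(* The cycle C_n when n > 2.                                                  *)
Definition cycle_graph n : sgraph 'I_n :=
  SGraph (@cycle_adj_sym n) (@cycle_adj_irrefl n).

Definition complete_adj n : rel 'I_n := fun x y => x != y.

Fact complete_adj_sym n : symmetric (@complete_adj n).
Proof. by move=> x y; rewrite /complete_adj eq_sym. Qed.

Fact complete_adj_irrefl n : irreflexive (@complete_adj n).
Proof. by move=> x; rewrite /complete_adj eqxx. Qed.

Definition complete_graph n : sgraph 'I_n :=
  SGraph (@complete_adj_sym n) (@complete_adj_irrefl n).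

Variables (V : finType) (G : sgraph V) (e : {set V}).

Definition delete_edge_adj : rel V := fun x y =>
  adj G x y && ([set x; y] != e).

Fact delete_edge_adj_sym : symmetric delete_edge_adj.
Proof. by move=> x y; rewrite /delete_edge_adj adj_sym setUC. Qed.

Fact delete_edge_adj_irrefl : irreflexive delete_edge_adj.
Proof. by move=> x; rewrite /delete_edge_adj adj_irrefl. Qed.

Definition delete_edge : sgraph V :=
  SGraph delete_edge_adj_sym delete_edge_adj_irrefl.

End Graphs.

Definition C4 : sgraph 'I_4 := cycle_graph 4.

Definition K4_minus_edge : sgraph 'I_4 :=
  delete_edge (complete_graph 4) [set ord0; ord_max].

(* Main.v *)
From HB Require Import structures.
Require Import Defs.
From mathcomp Require Import all_boot all_order all_algebra.

(* Represent M over the field of two elements by a set E of nonzero vectors.  *)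
(* Excluding the two minors amounts to a condition on chords: modulo the span *)
(* K of any subset of E, a 4-circuit a, b, c, d has at least two of the       *)
(* chords a + b, a + c, a + d in E. The three families satisfy it by a direct *)
(* computation. Conversely, it implies that every set F which is neither      *)
(* disjoint from E nor contains E is crossed by a triangle. If E contains a   *)
(* Fano plane, take a maximal subspace U of dimension at least 3 whose        *)
(* nonzero vectors are in E: a coset of U with two points of E misses at most *)
(* one, two such cosets beyond U yield a plane with too few chords, and the   *)
(* triangle property shows that nothing else is left. Otherwise, take a       *)
(* maximal independent D in E whose pairwise sums are in E: it is the star of *)
(* a vertex of a complete graph, E has no other points in the span of D, and  *)
(* a triangle leaving this span would provide a larger star.                  *)

Set Implicit Arguments.
Unset Strict Implicit.
Unset Printing Implicit Defensive.

Import GRing.Theory.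
Local Open Scope ring_scope.

(** A simple binary matroid is a set of distinct nonzero vectors over the field of two elements.
    Contraction keeps the vectors and enlarges the subspace modulo which they are read. By
    [induced_minor_shape], an induced minor is therefore described by a set [X] of contracted
    elements and a subspace [U]: modulo the span of [X], it represents every class of elements of
    the matroid that lie in [U] and are not loops.

    A 4-circuit [a, b, c, d] spans rank 3 and has three possible chords, the classes of [a + b],
    [a + c] and [a + d]. The cycle matroids of C4 and of K4 minus an edge are the 4-circuit with
    none and with exactly one of them. Excluding both is thus the same as asking, modulo the span of
    every [X], for one of any two chords; this is [has_chords], and the two directions are
    [has_chords_no_minor] and [no_minor_has_chords]. The three families have the property by
    [pg_has_chords] and [complete_has_chords].

    For the converse, [chordal_structure] classifies the sets of vectors [E] that are connected and
    have the chord property. Its two tools are [four_circuit], the property without contraction, and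
    [crossing_triangle], which turns connectedness into a triangle leaving any given part of [E].

    If [E] with 0 contains a subspace of dimension 3, [projective_structure] takes a maximal such
    subspace [U]. A coset of [U] with two points of [E] misses exactly one ([attached_missing]), and
    two independent cosets of this kind are contradictory ([two_missing]); so [E] is a projective
    geometry, possibly without one point.

    If there is no such subspace, [star_structure] grows an independent set [D] whose pairwise sums
    are in [E], like the edges at one vertex of a complete graph. Longer sums are excluded by
    [star_sum], a triangle leaving the span of [D] enlarges [D] by [star_extend], and at the end [E]
    consists of [D] and its pairwise sums, which are the edges of a complete graph. *)

(** * Computing over the field of two elements *)

Section CharTwo.

Variable W : lmodType 'F_2.
Implicit Types x y : W.

Lemma addv2 x : x + x = 0.
Proof.
rewrite -mulr2n -scaler_nat.
by rewrite (_ : 2%:R = 0) ?scale0r //; apply/eqP.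
Qed.

Lemma oppv x : - x = x.
Proof. by apply/eqP; rewrite eq_sym -addr_eq0 addv2. Qed.

Lemma addv_eq0 x y : (x + y == 0) = (x == y).
Proof. by rewrite addr_eq0 oppv. Qed.

Lemma mem_eq (A : {pred W}) x y : x \in A -> y = x -> y \in A.
Proof. by move=> xA ->. Qed.

Lemma addv_neq x y z : x + y = z -> z != 0 -> x != y.
Proof. by move=> <-; rewrite addv_eq0. Qed.

Inductive vexpr := VZero | VVar of nat | VAdd of vexpr & vexpr | VOpp of vexpr.

Fixpoint veval (env : seq W) e : W :=
  match e with
  | VZero => 0
  | VVar i => env`_i
  | VAdd e1 e2 => veval env e1 + veval env e2
  | VOpp e1 => - veval env e1
  end.

Fixpoint vcoef i e : bool :=
  match e with
  | VZero => false
  | VVar j => i == j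
  | VAdd e1 e2 => vcoef i e1 (+) vcoef i e2
  | VOpp e1 => vcoef i e1
  end.

Lemma vevalE env e :
  veval env e = \sum_(i < size env) (env`_i *+ vcoef i e).
Proof.
elim: e => [|j|e1 IH1 e2 IH2|e IH] /=.
- by rewrite big1.
- have [jenv|envj] := ltnP j (size env); last first.
    rewrite nth_default // big1 // => i _.
    by rewrite ltn_eqF // (leq_trans (ltn_ord i)).
  rewrite (bigD1 (Ordinal jenv)) //= eqxx big1 ?addr0 // => i.
  by rewrite -val_eqE /= => /negPf->.
- rewrite IH1 IH2 -big_split /=; apply: eq_bigr => i _.
  case: (vcoef i e1); case: (vcoef i e2); rewrite ?mulr0n ?mulr1n ?addr0 ?add0r //.
  by rewrite addv2.
- by rewrite IH oppv.
Qed.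

(* Over the field of two elements, two sums of the same atoms are equal as     *)
(* soon as every atom occurs in both with the same parity.                    *)
Lemma vevalP env e1 e2 :
  all (fun i => vcoef i e1 == vcoef i e2) (iota 0 (size env)) ->
  veval env e1 = veval env e2.
Proof.
move=> /allP e12; rewrite !vevalE; apply: eq_bigr => i _.
have /eqP-> // : vcoef i e1 == vcoef i e2.
by apply: e12; rewrite mem_iota /=.
Qed.

End CharTwo.

Ltac vindex x env :=
  lazymatch env with
  | x :: _ => constr:(0%N)
  | _ :: ?env' => let n := vindex x env' in constr:(S n)
  end.
(** [vindex] fails on an atom that is not yet listed, and the backtracking [match] then falls
    through to the branch that adds it. *)
Ltac vatoms t env :=
  lazymatch t with
  | 0%R => env
  | (?a + ?b)%R => let env' := vatoms a env in vatoms b env'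
  | (- ?a)%R => vatoms a env
  | _ => match env with
         | _ => let n := vindex t env in env
         | _ => constr:(t :: env)
         end
  end.
Ltac vquote t env :=
  lazymatch t with
  | 0%R => constr:(VZero)
  | (?a + ?b)%R =>
      let a' := vquote a env in let b' := vquote b env in constr:(VAdd a' b')
  | (- ?a)%R => let a' := vquote a env in constr:(VOpp a')
  | _ => let n := vindex t env in constr:(VVar n)
  end.

(** Both sides are reified over a common list of atoms, and [vevalP] leaves a comparison of parities
    that is decided by computation. *)
Ltac char2 :=
  lazymatch goal with
  | |- @eq ?V ?a ?b =>
      let env0 := constr:(@nil V) in
      let env1 := vatoms a env0 in
      let env := vatoms b env1 in
      let ea := vquote a env in
      let eb := vquote b env in
      refine (@vevalP _ env ea eb _); vm_compute; reflexivity
  end.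

(** * Symmetric differences, subset sums and spans *)

Definition symdiff (T : finType) (A B : {set T}) := (A :\: B) :|: (B :\: A).

Lemma symdiff_sub (T : finType) (A B C : {set T}) :
  A \subset C -> B \subset C -> symdiff A B \subset C.
Proof.
by move=> AC BC; rewrite subUset !(subset_trans (subsetDl _ _)).
Qed.

Lemma symdiff_eq0 (T : finType) (A B : {set T}) :
  (symdiff A B == set0) = (A == B).
Proof. by rewrite setU_eq0 !setD_eq0 eqEsubset. Qed.

(** Over the field of two elements these are the linear subspaces, as the only scalars are 0 and
    1. *)
Definition add_closed (W : nmodType) (K : {pred W}) : Prop :=
  0 \in K /\ {in K &, forall x y, x + y \in K}.

Lemma closedD (W : nmodType) (K : {pred W}) x y :
  add_closed K -> x \in K -> y \in K -> x + y \in K.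
Proof. by case=> _; apply. Qed.

Section Sums.

Variables (W : lmodType 'F_2) (T : finType) (phi : T -> W).
Implicit Types (A B I X Y : {set T}) (K : {pred W}).

Definition vsum A : W := \sum_(x in A) phi x.

Lemma vsum0 : vsum set0 = 0.
Proof. exact: big_set0. Qed.

Lemma vsum1 x : vsum [set x] = phi x.
Proof. exact: big_set1. Qed.

Lemma vsumU A B : [disjoint A & B] -> vsum (A :|: B) = vsum A + vsum B.
Proof.
by move=> AB; rewrite /vsum -bigU //; apply: eq_bigl => x; rewrite !inE.
Qed.

Lemma vsumU1 x A : x \notin A -> vsum (x |: A) = phi x + vsum A.
Proof. by move=> xA; rewrite /vsum big_setU1. Qed.

Lemma vsumD1 x A : x \in A -> vsum A = phi x + vsum (A :\ x).
Proof. by move=> xA; rewrite /vsum (big_setD1 x). Qed.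

Lemma vsumID A B : vsum A = vsum (A :&: B) + vsum (A :\: B).
Proof. exact: big_setID. Qed.

Lemma vsum_symdiff A B : vsum (symdiff A B) = vsum A + vsum B.
Proof.
rewrite vsumU; last first.
  by rewrite -setI_eq0; apply/eqP/setP => x; rewrite !inE; do 2!case: (x \in _).
rewrite (vsumID A B) (vsumID B A) (setIC B); char2.
Qed.

(** The linear span of the image of [X]: with coefficients 0 and 1, linear combinations are sums
    over subsets. *)
Definition F2span X : {pred W} :=
  [pred w | [exists A : {set T}, (A \subset X) && (w == vsum A)]].

Lemma F2spanP X (w : W) :
  reflect (exists2 A : {set T}, A \subset X & w = vsum A) (w \in F2span X).
Proof.
apply: (iffP existsP) => [[A /andP[AX /eqP->]]|[A AX ->]]; first by exists A.
by exists A; rewrite AX eqxx.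
Qed.

Lemma vsum_F2span A X : A \subset X -> vsum A \in F2span X.
Proof. by move=> AX; apply/F2spanP; exists A. Qed.

Lemma mem_F2span x X : x \in X -> phi x \in F2span X.
Proof. by move=> xX; rewrite -vsum1 vsum_F2span // sub1set. Qed.

Lemma F2span_closed X : add_closed (F2span X).
Proof.
split; first by rewrite -vsum0 vsum_F2span ?sub0set.
move=> _ _ /F2spanP[A AX ->] /F2spanP[B BX ->].
by rewrite -vsum_symdiff vsum_F2span ?symdiff_sub.
Qed.

Lemma vsum_closed K A : add_closed K -> {in A, forall x, phi x \in K} ->
  vsum A \in K.
Proof. by move=> [K0 KD] AK; apply: (big_ind (fun w => w \in K)). Qed.

Lemma sub_F2span K X : add_closed K -> {in X, forall x, phi x \in K} ->
  {subset F2span X <= K}.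
Proof.
move=> cK XK _ /F2spanP[A AX ->]; apply: vsum_closed => // x /(subsetP AX).
exact: XK.
Qed.

Lemma F2spanS X Y : X \subset Y -> {subset F2span X <= F2span Y}.
Proof.
by move=> XY _ /F2spanP[A AX ->]; rewrite vsum_F2span // (subset_trans AX).
Qed.

Lemma F2spanU X Y (w : W) : w \in F2span (X :|: Y) ->
  exists2 A : {set T}, A \subset Y & w + vsum A \in F2span X.
Proof.
case/F2spanP=> A AXY ->; exists (A :\: X).
  by rewrite subDset.
rewrite (_ : _ + _ = vsum (A :&: X)) ?vsum_F2span ?subsetIr //.
by rewrite (vsumID A X); char2.
Qed.

Lemma F2span0 : F2span set0 =i pred1 0.
Proof.
move=> w; apply/F2spanP/eqP => [[A]|->]; last by exists set0; rewrite ?vsum0.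
by rewrite subset0 => /eqP->; rewrite vsum0.
Qed.

(** For a subspace [K], linear independence of the family in the quotient by [K]; a repeated vector
    makes the family dependent. *)
Definition indep_mod K I := forall A, A \subset I -> vsum A \in K -> A = set0.

End Sums.

Lemma closed_addl (W : lmodType 'F_2) (K : {pred W}) x y : add_closed K ->
  x \in K -> (x + y \in K) = (y \in K).
Proof.
move=> [_ KD] xK; apply/idP/idP => [xyK|]; last exact: KD.
rewrite (_ : y = x + (x + y)); last by char2.
exact: KD.
Qed.

Lemma closed_addr (W : lmodType 'F_2) (K : {pred W}) x y : add_closed K ->
  y \in K -> (x + y \in K) = (x \in K).
Proof. by move=> cK yK; rewrite addrC closed_addl. Qed.

Lemma closed_trans (W : lmodType 'F_2) (K : {pred W}) x y z : add_closed K ->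
  x + y \in K -> y + z \in K -> x + z \in K.
Proof.
move=> [_ KD] xy yz; rewrite (_ : x + z = x + y + (y + z)); last by char2.
exact: KD.
Qed.

(* The subspace K is the span of the elements contracted so far, so that a    *)
(* minor is described by the same map phi as the matroid it comes from.       *)
Definition represents (W : lmodType 'F_2) (T : finType) (M : matroid T)
    (phi : T -> W) (K : {pred W}) : Prop :=
  forall I : {set T},
    I \in indeps M <-> I \subset ground M /\ indep_mod phi K I.

(** * Matroid notions read in a representation modulo a subspace *)

Lemma circuit_dep (T : finType) (M : matroid T) C : circuit M C ->
  [/\ C \subset ground M, C \notin indeps M &
      forall D : {set T}, D \proper C -> D \in indeps M].
Proof.
by case/and3P=> CM CI /forallP Cm; split=> // D; apply/implyP/Cm.
Qed.

Section Represented.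

Variables (W : lmodType 'F_2) (T : finType) (M : matroid T) (phi : T -> W).
Variable K : {pred W}.
Hypotheses (cK : add_closed K) (rM : represents M phi K).
Implicit Types (A B C F I X S : {set T}) (x y : T).

Local Notation vsum := (vsum phi).

Lemma rep_dep A : A \subset ground M -> A != set0 -> vsum A \in K ->
  A \notin indeps M.
Proof.
move=> AM A0 AK; apply/negP => /rM[_ /(_ A (subxx _) AK)] /eqP.
by rewrite (negPf A0).
Qed.

Lemma rep_depP A : A \subset ground M -> A \notin indeps M ->
  exists B : {set T}, [/\ B \subset A, B != set0 & vsum B \in K].
Proof.
move=> AM AI.
have [/existsP[B /and3P[BA B0 BK]]|/existsPn nB] :=
  boolP [exists B : {set T}, [&& B \subset A, B != set0 & vsum B \in K]].
  by exists B.
case/negP: AI; apply/rM; split=> // B BA BK; apply/eqP.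
by move: (nB B); rewrite BA BK /= andbT negbK.
Qed.

(** A dependent set has a nonempty subset with sum in [K]; that subset is itself dependent, so by
    minimality it is the whole circuit. *)
Lemma circuit_vsum C : circuit M C -> vsum C \in K.
Proof.
case/circuit_dep=> CM CI Cm; have [B [BC B0 BK]] := rep_depP CM CI.
suff -> : C = B by [].
apply/eqP; rewrite eqEsubset BC andbT; apply: contraT => nCB.
have /Cm : B \proper C by rewrite properE BC.
by move=> BI; have /negP := rep_dep (subset_trans BC CM) B0 BK.
Qed.

Lemma loopE x : x \in ground M -> loop M x = (phi x \in K).
Proof.
move=> xM; apply/idP/idP => [/circuit_vsum|xK]; first by rewrite vsum1.
rewrite /loop /circuit sub1set xM rep_dep ?sub1set ?vsum1 //=; last first.
  by rewrite -card_gt0 cards1.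
apply/forallP => D; apply/implyP => /properP[Dx [y]].
rewrite inE => /eqP-> xD; suff -> : D = set0 by apply: indep0.
apply/setP => z; rewrite inE; apply/negP => zD.
by move: (subsetP Dx z zD); rewrite inE => /eqP zx; rewrite -zx zD in xD.
Qed.

Lemma indep1 x : x \in ground M -> phi x \notin K -> [set x] \in indeps M.
Proof.
move=> xM xK; apply/rM; rewrite sub1set xM; split=> // A.
rewrite subset1 => /orP[/eqP->|/eqP//].
by rewrite vsum1 (negPf xK).
Qed.

Lemma parallelP x y : reflect
  [/\ x != y, x \in ground M, y \in ground M, phi x \notin K &
      (phi y \notin K) /\ (phi x + phi y \in K)]
  (parallel M x y).
Proof.
apply: (iffP andP) => [[xy cxy]|[xy xM yM xK [yK xyK]]].
  have := circuit_vsum cxy; have [+ _ Cm] := circuit_dep cxy.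
  rewrite subUset !sub1set => /andP[xM yM].
  rewrite vsumU1 ?inE // vsum1 => xyK.
  have ind z : z \in [set x; y] -> phi z \notin K.
    move=> zxy; have zp : [set z] \proper [set x; y].
      by rewrite properEcard sub1set zxy cards1 cards2 xy.
    apply: contraL (Cm _ zp) => zK; apply: rep_dep.
    - by rewrite sub1set; case/set2P: zxy => ->.
    - by rewrite -card_gt0 cards1.
    - by rewrite vsum1.
  by split=> //; [|split=> //]; apply: ind; rewrite !inE eqxx ?orbT.
split=> //; rewrite /circuit subUset !sub1set xM yM rep_dep //=.
- apply/forallP => D; apply/implyP => /properP[Dxy [z zxy zD]].
  have Dind t : t \in [set x; y] -> t != z -> D \in indeps M.
    move=> txy tz; have D1 : D \subset [set t].
      apply/subsetP => s sD; move: (subsetP Dxy s sD) zxy txy.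
      rewrite !inE; have sz : s != z by apply: contraNneq zD => <-.
      case/orP=> /eqP ss /orP[] /eqP zz /orP[] /eqP tt; move: sz tz;
        rewrite ?ss ?zz ?tt ?eqxx //.
    by apply: indepS D1; case/set2P: txy => ->; apply: indep1.
  have [zx|zx] := eqVneq x z; last by apply: Dind zx; rewrite !inE eqxx.
  by apply: (Dind y); rewrite ?inE ?eqxx ?orbT // -zx eq_sym.
- by rewrite subUset !sub1set xM.
- by rewrite -card_gt0 cards2.
- by rewrite vsumU1 ?inE // vsum1.
Qed.

Lemma rep_restrict A : represents (restrict M A) phi K.
Proof.
move=> I /=; rewrite inE subsetI; split=> [/andP[/rM[-> iI] ->]//|].
by case=> /andP[IM ->] iI; rewrite andbT; apply/rM.
Qed.

(** For [x] outside [B], maximality makes [x |: B] dependent, and the subset with sum in [K] must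
    contain [x] because [B] is independent. *)
Lemma basis_vsum X B x : X \subset ground M -> basis M X B -> x \in X ->
  exists2 A : {set T}, A \subset B & phi x + vsum A \in K.
Proof.
move=> XM bB xX; have [xB|xB] := boolP (x \in B).
  by exists [set x]; rewrite ?sub1set // vsum1 addv2; case: cK.
have xBI : x |: B \notin indeps M.
  by apply: contra xB => xBI; apply: basis_max bB xX xBI.
have xBM : x |: B \subset ground M.
  rewrite subUset sub1set (subsetP XM) //=.
  exact: indep_sub_ground (basis_indep bB).
have [A [AxB A0 AK]] := rep_depP xBM xBI.
have [_ iB] := (rM B).1 (basis_indep bB).
have xA : x \in A.
  apply: contraT => xA; case/eqP: A0; apply: iB => //.
  apply/subsetP => z zA; move: (subsetP AxB z zA).
  by case/setU1P => // zx; rewrite -zx zA in xA.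
exists (A :\ x); last by rewrite -vsumD1.
by rewrite subDset.
Qed.

(** The vectors congruent modulo [K] to a sum over a subset of [B] form a subspace, which contains
    the image of [X] by [basis_vsum]. *)
Lemma span_basis X B (w : W) : X \subset ground M -> basis M X B ->
  w \in F2span phi X -> exists2 A : {set T}, A \subset B & w + vsum A \in K.
Proof.
move=> XM bB.
pose P : {pred W} :=
  [pred w | [exists A : {set T}, (A \subset B) && (w + vsum A \in K)]].
have cP : add_closed P.
  split=> [|y z /existsP[C /andP[CB yC]] /existsP[D /andP[DB zD]]].
    by apply/existsP; exists set0; rewrite sub0set vsum0 addr0; case: cK.
  apply/existsP; exists (symdiff C D); rewrite symdiff_sub // vsum_symdiff /=.
  rewrite (_ : y + z + _ = y + vsum C + (z + vsum D)); last by char2.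
  exact: closedD.
move/(sub_F2span cP) => wP; suff /existsP[A /andP[AB wA]] : w \in P by exists A.
apply: wP => x xX; have [A AB xA] := basis_vsum XM bB xX.
by apply/existsP; exists A; rewrite AB.
Qed.

Lemma rank_basis X B : basis M X B -> rank M X = #|B|.
Proof.
move=> bB; apply/eqP; rewrite eqn_leq; apply/andP; split; last first.
  by apply: (bigmax_sup B) => //; rewrite (basis_indep bB) (basis_sub bB).
apply/bigmax_leqP => I /andP[II IX]; rewrite leqNgt; apply/negP => lt.
have [x] := indep_aug (basis_indep bB) II lt.
rewrite inE => /andP[xB xI] xBI; case/negP: xB.
exact: basis_max bB (subsetP IX x xI) xBI.
Qed.

(** A basis of [F] remains a basis of [x |: F], because [phi x] is congruent modulo [K] to a sum
    over a subset of it; adding [x] does not raise the rank. *)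
Lemma flat_span F x A : flat M F -> x \in ground M -> A \subset F ->
  phi x + vsum A \in K -> x \in F.
Proof.
move=> /andP[FM /eqP FE] xM AF xAK; rewrite -FE inE xM /=; apply/eqP.
have [xF|xF] := boolP (x \in F); first by rewrite (setUidPr _) ?sub1set.
have [B bB] := basis_exists M F.
suff b' : basis M (x |: F) B by rewrite (rank_basis bB) (rank_basis b').
apply/maxsetP; split.
  by rewrite (basis_indep bB) (subset_trans (basis_sub bB)) ?subsetUr.
move=> C /andP[CI CxF] BC; apply/eqP; rewrite eqEsubset BC andbT.
have CF z : z \in C -> z \in F -> z \in B.
  move=> zC zF; apply: (basis_max bB zF); apply: indepS CI _.
  by rewrite subUset sub1set zC.
apply/subsetP => z zC; apply: CF => //.
have /setU1P[zx|//] := subsetP CxF z zC; rewrite {z}zx in zC *.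
have [A' A'B xA'] : exists2 A' : {set T}, A' \subset B & phi x + vsum A' \in K.
  have [A' A'B AA'] := span_basis FM bB (vsum_F2span phi AF).
  by exists A' => //; apply: closed_trans xAK AA'.
have xA'n : x \notin A'.
  by apply: contra xF => /(subsetP A'B)/(subsetP (basis_sub bB)).
have [_ iC] := (rM C).1 CI; have /setP/(_ x) : x |: A' = set0.
  by apply: iC; rewrite ?vsumU1 // subUset sub1set zC (subset_trans A'B).
by rewrite !inE eqxx.
Qed.

(** An element outside [U] extends a basis of this set to a larger independent set, so it raises the
    rank. This provides the flats to which minors are restricted. *)
Lemma flat_closed (U : {pred W}) : add_closed U -> {subset K <= U} ->
  flat M [set x in ground M | phi x \in U].
Proof.
move=> cU KU; set F := finset _.
have FM : F \subset ground M by apply/subsetP => x; rewrite inE => /andP[].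
rewrite /flat FM /=; apply/eqP/setP => x; rewrite inE; apply/andP/idP; last first.
  move=> xF; rewrite (setUidPr _) ?sub1set //.
  by rewrite (subsetP FM).
case=> xM; rewrite [x \in F]inE xM /=; apply: contraTT => xU.
have [B bB] := basis_exists M F; rewrite (rank_basis bB).
have xF : x \notin F by rewrite inE xM.
have xB : x \notin B by apply: contra xF; apply: (subsetP (basis_sub bB)).
suff : (#|x |: B| <= rank M (x |: F))%N.
  by rewrite cardsU1 xB add1n => /gtn_eqF->.
apply: (bigmax_sup (x |: B)) => //.
rewrite setUS ?(basis_sub bB) // andbT; apply/rM; split.
  by rewrite subUset sub1set xM (indep_sub_ground (basis_indep bB)).
have [_ iB] := (rM B).1 (basis_indep bB).
have BU A : A \subset B -> vsum A \in U.
  move=> AB; apply: vsum_closed => // z /(subsetP AB)/(subsetP (basis_sub bB)).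
  by rewrite inE => /andP[].
move=> A AxB AK; have [xA|xA] := boolP (x \in A); last first.
  apply: iB => //; apply/subsetP => z zA; move: (subsetP AxB z zA).
  by case/setU1P => // zx; rewrite -zx zA in xA.
have AxU : vsum (A :\ x) \in U by apply: BU; rewrite subDset.
by case/negP: xU; rewrite -(closed_addr _ cU AxU) -vsumD1 // KU.
Qed.

Lemma simplifying_set_exists : exists S, simplifying_set M S.
Proof.
(* [rp x] depends only on the class of [phi x] modulo [K], so [S] keeps exactly one element of each
   class of non-loops. *)
pose rp x := [pick y | [&& y \in ground M, phi y \notin K & phi x + phi y \in K]].
pose S := [set x in ground M | (phi x \notin K) && (rp x == Some x)].
have rpE x y : phi x + phi y \in K -> rp x = rp y.
  move=> xy; apply: eq_pick => z /=; congr [&& _, _ & _].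
  apply/idP/idP; apply: closed_trans => //; by rewrite addrC.
exists S; split=> [|x|x xM].
- by apply/subsetP => x; rewrite inE => /andP[].
- by rewrite inE => /and3P[xM xK _]; rewrite loopE.
rewrite loopE // => xK.
have [r rx] : exists r, rp x = Some r.
  rewrite /rp; case: pickP => [r|/(_ x)]; first by exists r.
  by rewrite xM xK addv2 (proj1 cK).
have [rM' rK xr] : [/\ r \in ground M, phi r \notin K & phi x + phi r \in K].
  by move: rx; rewrite /rp; case: pickP => // y /and3P[? ? ?] [<-].
apply/eqP/cards1P; exists r; apply/setP => y; rewrite !inE.
apply/andP/eqP => [[/and3P[yM yK /eqP ry] xy]|->].
  have {}xy : phi x + phi y \in K.
    case/orP: xy => [/eqP->|/parallelP[_ _ _ _ []//]].
    by rewrite addv2; case: cK.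
  by apply: Some_inj; rewrite -ry -rx (rpE _ _ xy).
rewrite rM' rK -(rpE _ _ xr) rx eqxx; split=> //.
by have [//|rx'] := eqVneq r x; apply/parallelP; rewrite eq_sym.
Qed.

End Represented.

(** * Contractions, vector matroids and isomorphisms in terms of representations *)

(** Modulo the old subspace a basis of [X] spans as much as [X], so being independent together with
    a basis of [X] is being independent modulo the larger span. *)
Lemma rep_contract (W : lmodType 'F_2) (T : finType) (M : matroid T)
    (phi : T -> W) (X Y : {set T}) :
  X \subset ground M -> represents M phi (F2span phi Y) ->
  represents (contract M X) phi (F2span phi (Y :|: X)).
Proof.
move=> XM rM I /=; have cY := F2span_closed phi Y.
have YYX : {subset F2span phi Y <= F2span phi (Y :|: X)}.
  exact/F2spanS/subsetUl.
rewrite inE; split=> [/andP[IMX /existsP[B /andP[bB IB]]]|[IMX iI]].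
  split=> // A AI /F2spanU[A' A'X AA'].
  have [A'' A''B A'A''] := span_basis cY rM XM bB (vsum_F2span phi A'X).
  have [_ /(_ (A :|: A''))] := (rM _).1 IB.
  have dA : [disjoint A & A''].
    rewrite -setI_eq0; apply/eqP/setP => z; rewrite !inE; apply/negP => /andP[].
    move=> /(subsetP AI)/(subsetP IMX); rewrite inE => /andP[/negP zX _].
    by move=> /(subsetP A''B)/(subsetP (basis_sub bB)).
  rewrite setUSS // vsumU // => /(_ isT) /(_ (closed_trans cY AA' A'A'')).
  by move/eqP; rewrite setU_eq0 => /andP[/eqP].
rewrite IMX /=; have [B bB] := basis_exists M X; apply/existsP; exists B.
rewrite bB /=; apply/rM; split.
  rewrite subUset (indep_sub_ground (basis_indep bB)) andbT.
  exact: subset_trans IMX (subsetDl _ _).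
move=> A AIB AY; have [_ iB] := (rM B).1 (basis_indep bB).
have ABB : A :\: I \subset B by rewrite subDset.
have AI0 : A :&: I = set0.
  apply: iI; first exact: subsetIr.
  rewrite -(closed_addr (y := vsum phi (A :\: I)) _ (F2span_closed _ _)).
    by rewrite -vsumID YYX.
  apply: vsum_F2span; apply: subset_trans ABB _.
  exact: subset_trans (basis_sub bB) (subsetUr _ _).
by apply: iB => //; rewrite -(setID A I) AI0 set0U.
Qed.

Lemma vspace_F2span (V : vectType 'F_2) (T : finType) (v : T -> V) (I : {set T}) :
  <<[seq v x | x <- enum I]>>%VS =i F2span v I.
Proof.
move=> w; apply/idP/F2spanP => [wI|[A AI ->]].
  apply/F2spanP.
  rewrite (@coord_span _ _ _ (in_tuple [seq v x | x <- enum I]) w wI).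
  have [span0 spanD] := F2span_closed v I.
  elim/big_ind: _ => // i _.
  have F2E (c : 'F_2) : c = 0 \/ c = 1.
    by case: c => -[|[|//]] ci; [left|right]; apply/val_inj.
  have [->|->] := F2E (coord (in_tuple [seq v x | x <- enum I]) i w).
    by rewrite scale0r.
  rewrite scale1r; have /mapP[x xI ->] := mem_nth 0 (ltn_ord i).
  by apply: mem_F2span; rewrite mem_enum in xI.
apply: memv_suml => x xA; apply/memv_span/map_f.
by rewrite mem_enum (subsetP AI).
Qed.

Lemma vec_indepP (V : vectType 'F_2) (T : finType) (v : T -> V) (I : {set T}) :
  vec_indep v I <-> indep_mod v (F2span v set0) I.
Proof.
have mem0 w : (w \in F2span v set0) = (w == 0) by rewrite F2span0.
have [n] := ubnP #|I|; elim: n I => // n IH I ltIn.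
have [->|[x xI]] := set_0Vmem I.
  rewrite /vec_indep enum_set0 nil_free; split=> // _ A.
  by rewrite subset0 => /eqP.
have {}IH : vec_indep v (I :\ x) <-> indep_mod v (F2span v set0) (I :\ x).
  by apply: IH; move: ltIn; rewrite (cardsD1 x) xI.
rewrite -[in X in X <-> _](setD1K xI) vec_indepU1 ?setD11 // vspace_F2span.
split=> [/andP[xn /IH iI] A AI|iI].
  rewrite mem0; have [xA|xA] := boolP (x \in A); last first.
    move=> A0; apply: iI; rewrite ?mem0 //; apply/subsetP => z zA.
    by rewrite !inE (subsetP AI) // andbT; apply: contraNneq xA => <-.
  rewrite (vsumD1 v xA) addv_eq0 => /eqP vx; case/negP: xn.
  by rewrite vx vsum_F2span // setSD.
apply/andP; split; last first.
  by apply/IH => A AI; apply: iI; apply: subset_trans AI (subsetDl _ _).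
apply/F2spanP => -[A AI vx]; have xA : x \notin A.
  by apply/negP => /(subsetP AI); rewrite setD11.
have /setP/(_ x) : x |: A = set0.
  apply: iI; last by rewrite mem0 vsumU1 // vx addv2.
  by rewrite subUset sub1set xI (subset_trans AI) ?subsetDl.
by rewrite !inE eqxx.
Qed.

(** The zero subspace is written as the span of the empty set, so that contractions keep the form
    [F2span phi X]. *)
Lemma rep_vector (V : vectType 'F_2) (T : finType) (E : {set T}) (v : T -> V) :
  represents (vector_matroid E v) v (F2span v set0).
Proof.
move=> I; rewrite inE; split=> [/andP[-> /vec_indepP]//|[-> iI]].
exact/vec_indepP.
Qed.

(** Along the common index type [R] the two families agree modulo [K] on [I], hence so do their
    subset sums. *)
Lemma indep_mod_imset (W : lmodType 'F_2) (R T U : finType) (phi : T -> W)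
    (psi : U -> W) (K : {pred W}) (f : R -> T) (g : R -> U) (I : {set R}) :
  add_closed K -> {in I &, injective f} -> {in I &, injective g} ->
  {in I, forall s, phi (f s) + psi (g s) \in K} ->
  indep_mod phi K (f @: I) -> indep_mod psi K (g @: I).
Proof.
move=> cK injf injg fg iI B BI BK.
pose A := [set s in I | g s \in B].
have AI : A \subset I by apply/subsetP => s; rewrite inE => /andP[].
have BE : B = g @: A.
  apply/setP => y; apply/idP/imsetP => [yB|[s]]; last by rewrite inE => /andP[_ sB] ->.
  have /imsetP[s sI yE] := subsetP BI y yB.
  by exists s; rewrite // inE sI -yE.
have injfA : {in A &, injective f}.
  by move=> s t /(subsetP AI) sI /(subsetP AI); apply: injf.
have injgA : {in A &, injective g}.
  by move=> s t /(subsetP AI) sI /(subsetP AI); apply: injg.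
have A0 : f @: A = set0.
  apply: iI; first exact: imsetS.
  rewrite -(closed_addr _ cK BK) BE /vsum !big_imset //= -big_split /=.
  case: (cK) => K0 KD; elim/big_ind: _ => // s /(subsetP AI); exact: fg.
rewrite BE; apply/eqP; rewrite imset_eq0; move/eqP: A0; by rewrite imset_eq0.
Qed.

Lemma rep_isomorphic (W : lmodType 'F_2) (T U : finType) (M : matroid T)
    (N : matroid U) (phi : T -> W) (psi : U -> W) (K : {pred W}) :
  add_closed K -> represents M phi K -> represents N psi K ->
  {in ground M &, forall x y, phi x + phi y \in K -> x = y} ->
  {in ground N &, forall x y, psi x + psi y \in K -> x = y} ->
  {in ground M, forall x, exists2 y, y \in ground N & phi x + psi y \in K} ->
  {in ground N, forall y, exists2 x, x \in ground M & phi x + psi y \in K} ->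
  isomorphic M N.
Proof.
move=> cK rM rN injM injN MN NM.
have exf (x : {x | x \in ground M}) :
    exists y : {y | y \in ground N}, phi (val x) + psi (val y) \in K.
  by have [y yN xy] := MN _ (valP x); exists (Sub y yN).
have exg (y : {y | y \in ground N}) :
    exists x : {x | x \in ground M}, phi (val x) + psi (val y) \in K.
  by have [x xM xy] := NM _ (valP y); exists (Sub x xM).
pose f x := xchoose (exf x); pose g y := xchoose (exg y).
have fK x : phi (val x) + psi (val (f x)) \in K := xchooseP (exf x).
have gK y : phi (val (g y)) + psi (val y) \in K := xchooseP (exg y).
have fg : cancel f g.
  move=> x; apply/val_inj/injM; [exact: valP|exact: valP|].
  apply: closed_trans (gK (f x)) _ => //; by rewrite addrC.
have gf : cancel g f.
  move=> y; apply/val_inj/injN; [exact: valP|exact: valP|].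
  apply: closed_trans _ (gK y) => //; by rewrite addrC.
exists f; first by exists g.
move=> I; rewrite -imset_comp.
have sM : val @: I \subset ground M.
  by apply/subsetP => _ /imsetP[x _ ->]; apply: valP.
have sN : (val \o f) @: I \subset ground N.
  by apply/subsetP => _ /imsetP[x _ ->]; apply: valP.
have injf : {in I &, injective (val \o f)}.
  by move=> x y _ _ /val_inj/(can_inj fg).
have injv : {in I &, injective (val : {x | x \in ground M} -> T)}.
  by move=> x y _ _ /val_inj.
apply/idP/idP => [/rM|/rN] [_ iI]; [apply/rN|apply/rM]; split=> //.
  exact: indep_mod_imset injv injf _ iI.
by apply: indep_mod_imset injf injv _ iI => // x _; rewrite addrC.
Qed.

Lemma isomorphic_rep (W : lmodType 'F_2) (T U : finType) (M : matroid T)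
    (N : matroid U) (psi : U -> W) (K : {pred W}) :
  add_closed K -> isomorphic M N -> represents N psi K ->
  exists phi : T -> W,
    [/\ represents M phi K,
        {in ground N &, injective psi} -> {in ground M &, injective phi},
        {in ground M, forall x, exists2 y, y \in ground N & phi x = psi y} &
        {in ground N, forall y, exists2 x, x \in ground M & phi x = psi y}].
Proof.
move=> cK [f [g fg gf] fI] rN.
(* The representation of [N] is pulled back along the isomorphism; 0 is a mere default outside the
   ground set of [M]. *)
pose phi x := if insub x is Some u then psi (val (f u)) else 0.
have phiE u : phi (val u) = psi (val (f u)) by rewrite /phi valK.
exists phi; split=> [I|injpsi x y xM yM|x xM|y yN].
- have [IM|IM] := boolP (I \subset ground M); last first.
    by split=> [/indep_sub_ground II|[//]]; rewrite II in IM.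
  pose J : {set {x | x \in ground M}} := [set u | val u \in I].
  have IE : I = val @: J.
    apply/setP => x; apply/idP/imsetP => [xI|[u]]; last by rewrite inE => uI ->.
    by exists (Sub x (subsetP IM x xI)); rewrite // inE.
  have injf : {in J &, injective (val \o f)}.
    by move=> u v _ _ /val_inj/(can_inj fg).
  have injv : {in J &, injective (val : {x | x \in ground M} -> T)}.
    by move=> u v _ _ /val_inj.
  have phiK u : phi (val u) + psi (val (f u)) \in K.
    by rewrite phiE addv2; case: cK.
  rewrite [X in X \in indeps M]IE fI -imset_comp; split=> [/rN[_ iI]|[_ iI]].
    split=> //; rewrite IE; apply: indep_mod_imset injf injv _ iI => // u _.
    by rewrite addrC.
  apply/rN; split; first by apply/subsetP => _ /imsetP[u _ ->]; apply: valP.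
  by move: iI; rewrite {1}IE => iI; apply: indep_mod_imset injv injf _ iI.
- have := phiE (Sub x xM); have := phiE (Sub y yM); rewrite !SubK => -> ->.
  move=> fxy; have /val_inj/(can_inj fg) := injpsi _ _ (valP _) (valP _) fxy.
  by case.
- exists (val (f (Sub x xM))); first exact: valP.
  by rewrite -phiE SubK.
- exists (val (g (Sub y yN))); first exact: valP.
  by rewrite phiE gf SubK.
Qed.

(** * Induced minors inside the representation of the original matroid *)

(** The last clause is what the invariant is for: an element found in [M], such as a chord, can be
    replaced by a parallel one in the minor once it lies in [U] and is not a loop modulo [X]. *)
Lemma induced_minor_shape (W : lmodType 'F_2) (T : finType) (M N : matroid T)
    (phi : T -> W) :
  represents M phi (F2span phi set0) -> induced_minor M N ->
  exists (X : {set T}) (U : {pred W}),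
    [/\ X \subset ground M, add_closed U, ground N \subset ground M &
        represents N phi (F2span phi X)] /\
    [/\ {in X, forall x, phi x \in U}, {in ground N, forall x, phi x \in U} &
        {in ground M, forall x, phi x \in U -> phi x \notin F2span phi X ->
         exists2 y, y \in ground N & phi x + phi y \in F2span phi X}].
Proof.
move=> rM; elim=> {N} [|N F _ [X [U [[XM cU NM rN] [XU NU MU]]]] fF
                        |N Y S _ [X [U [[XM cU NM rN] [XU NU MU]]]] YN sS].
- exists set0, (fun=> true); split; split=> //; first exact: sub0set.
  move=> x xM _ _; exists x => //; rewrite addv2; by case: (F2span_closed phi set0).
- have FN : F \subset ground N by case/andP: fF.
  (* For a flat [F] the subspace shrinks to the span of [X] and [F]; a representative in this span
     belongs to [F] by [flat_span]. *)
  exists X, (F2span phi (X :|: F)); split; split=> //=.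
  + exact: F2span_closed.
  + by apply: subset_trans NM; apply: subsetIl.
  + exact: rep_restrict.
  + by move=> x xX; apply: mem_F2span; rewrite inE xX.
  + by move=> x /setIP[_ xF]; apply: mem_F2span; rewrite inE xF orbT.
  move=> x xM xXF xX; have [|y yN xy] := MU x xM _ xX.
    apply: (sub_F2span cU) xXF => z /setUP[/XU//|/(subsetP FN)]; exact: NU.
  exists y => //; rewrite inE yN /=; have [A AF xA] := F2spanU xXF.
  apply: (flat_span (F2span_closed phi X) rN fF yN AF).
  by apply: closed_trans xA; rewrite 1?addrC //; apply: F2span_closed.
have [SN Sl S1] := sS; have cXY := F2span_closed phi (X :|: Y).
have rNY := rep_contract YN rN.
exists (X :|: Y), U; split; split=> //=.
- by rewrite subUset XM (subset_trans YN).
- by apply: subset_trans NM; apply: subset_trans (subsetIl _ _) (subsetDl _ _).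
- exact: rep_restrict.
- by move=> x /setUP[/XU//|/(subsetP YN)/NU].
- by move=> x /setIP[/setDP[/NU]].
move=> x xM xU xXY; have XXY : {subset F2span phi X <= F2span phi (X :|: Y)}.
  exact/F2spanS/subsetUl.
have [|y yN xy] := MU x xM xU; first by apply: contra xXY; apply: XXY.
have yXY : phi y \notin F2span phi (X :|: Y).
  by apply: contra xXY => yXY; rewrite -(closed_addr _ cXY yXY) XXY.
have yY : y \notin Y by apply: contra yXY => yY; rewrite mem_F2span // inE yY orbT.
have yNY : y \in ground (contract N Y) by rewrite /= inE yY.
have := S1 y yNY; rewrite (loopE rNY) // => /(_ yXY) /eqP/cards1P[z].
move/setP/(_ z); rewrite !inE eqxx => /andP[zS yz]; exists z.
  by rewrite inE zS (subsetP SN).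
have {}yz : phi y + phi z \in F2span phi (X :|: Y).
  case/orP: yz => [/eqP->|/(parallelP rNY)[_ _ _ _ []//]].
  by rewrite addv2; case: cXY.
by apply: closed_trans yz => //; apply: XXY.
Qed.

(* A 4-circuit of the contraction by X has two of its three chords; by        *)
(* symmetry it is enough to ask for one of any two.                           *)
Definition has_chords (W : lmodType 'F_2) (T : finType) (M : matroid T)
    (phi : T -> W) : Prop :=
  forall (X : {set T}) (a b c d : T), let K := F2span phi X in
    X \subset ground M -> a \in ground M -> b \in ground M -> c \in ground M ->
    d \in ground M -> phi a + phi b + phi c + phi d \in K ->
    [/\ phi a \notin K, phi b \notin K, phi c \notin K & phi d \notin K] ->
    [/\ phi a + phi b \notin K, phi a + phi c \notin K &
        phi a + phi d \notin K] ->
    exists2 x, x \in ground M &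
      (phi a + phi b + phi x \in K) || (phi a + phi c + phi x \in K).

(** * Cycle matroids represented by vectors attached to the vertices *)

Lemma edge_vec_inj (V : finType) : injective (@edge_vec V).
Proof.
move=> e f /ffunP ef; apply/setP => z; move: (ef z); rewrite !ffunE.
by do 2!case: (z \in _).
Qed.

Lemma edge_vec_eq0 (V : finType) (e : {set V}) : (edge_vec e == 0) = (e == set0).
Proof.
rewrite -(inj_eq (@edge_vec_inj V)); congr (_ == _).
by apply/ffunP => z; rewrite !ffunE inE.
Qed.

Lemma edge_vec_symdiff (V : finType) (e f : {set V}) :
  edge_vec (symdiff e f) = edge_vec e + edge_vec f.
Proof.
apply/ffunP => z; rewrite !ffunE !inE.
case: (z \in e); case: (z \in f); rewrite ?addr0 ?add0r //.
by apply/val_inj.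
Qed.

Lemma odd_symdiff (T : finType) (A B : {set T}) :
  odd #|symdiff A B| = odd #|A| (+) odd #|B|.
Proof.
have -> : #|symdiff A B| = (#|A :\: B| + #|B :\: A|)%N.
  rewrite cardsU [_ :&: _](_ : _ = set0) ?cards0 ?subn0 //.
  by apply/setP => x; rewrite !inE; do 2!case: (x \in _).
rewrite -(cardsID B A) -[X in _ (+) odd X](cardsID A B) (setIC B A) !oddD.
by do 3!case: (odd _).
Qed.

Lemma rep_edge_vec (V : finType) (G : sgraph V) :
  represents (cycle_matroid G) (@edge_vec V) (F2span (@edge_vec V) set0).
Proof.
move=> I; have := rep_vector (edges G) (@edge_vec V) I.
by rewrite -g_indepsE.
Qed.

Lemma edge_card2 (V : finType) (G : sgraph V) e : e \in edges G -> #|e| = 2%N.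
Proof. by case/edgesP => u [w [uw ->]]; rewrite cards2 uw. Qed.

Lemma edgeE (V : finType) (G : sgraph V) x y :
  ([set x; y] \in edges G) = adj G x y.
Proof.
apply/imsetP/idP => [[[u w]]|xy]; last by exists (x, y); rewrite ?inE.
rewrite inE /= => uw exy.
have uw' : u != w by apply: contraTneq uw => ->; rewrite adj_irrefl.
have xuw : x \in [set u; w] by rewrite -exy !inE eqxx.
have yuw : y \in [set u; w] by rewrite -exy !inE eqxx orbT.
have xy : x != y.
  by have := cards2 x y; rewrite exy cards2 uw'; case: (x != y).
case/set2P: xuw xy => ->; case/set2P: yuw => ->; rewrite ?eqxx // => _.
by rewrite adj_sym.
Qed.

(* Every edge contributes an even set of vertices, and sums of edges          *)
(* correspond to symmetric differences of these sets.                         *)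
Lemma rep_cycle (W : lmodType 'F_2) (V : finType) (G : sgraph V) (d : V -> W)
    (K : {pred W}) :
  (forall B : {set V}, ~~ odd #|B| -> vsum d B \in K -> B = set0) ->
  add_closed K -> represents (cycle_matroid G) (vsum d) K.
Proof.
move=> dK cK I.
have even (A : {set {set V}}) : A \subset edges G -> exists B : {set V},
    [/\ ~~ odd #|B|, vsum (vsum d) A = vsum d B &
        vsum (@edge_vec V) A = edge_vec B].
  move=> AG; rewrite /vsum.
  elim/big_ind2: _ => [|u f v g [B [oB -> ->]] [C [oC -> ->]]|e eA].
  - exists set0; rewrite cards0 big_set0; split=> //.
    by apply/esym/eqP; rewrite edge_vec_eq0.
  - exists (symdiff B C); rewrite odd_symdiff (negPf oB) (negPf oC).
    by split; rewrite ?edge_vec_symdiff // -[RHS]/(vsum d _) vsum_symdiff.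
  by exists e; rewrite (edge_card2 (subsetP AG e eA)).
have zero (A : {set {set V}}) : A \subset edges G ->
    (vsum (vsum d) A \in K) = (vsum (@edge_vec V) A \in F2span (@edge_vec V) set0).
  move=> /even[B [oB -> ->]]; rewrite F2span0 inE edge_vec_eq0.
  apply/idP/eqP => [/dK->//|->]; by rewrite vsum0; case: cK.
split=> [/rep_edge_vec|] [IG iI].
  by split=> // A AI AK; apply: iI => //; rewrite -zero // (subset_trans AI).
apply/rep_edge_vec; split=> // A AI AK; apply: iI => //.
by rewrite zero // (subset_trans AI).
Qed.

(** * The chord property excludes both minors *)

Definition indep3 (W : lmodType 'F_2) (T : finType) (phi : T -> W)
    (K : {pred W}) x y z : Prop :=
  [/\ phi x \notin K, phi y \notin K & phi z \notin K] /\
  [/\ phi x + phi y \notin K, phi x + phi z \notin K, phi y + phi z \notin K &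
      phi x + phi y + phi z \notin K].

(** Spelled out along an explicit list, a subset sum can be treated by cases on membership. *)
Lemma vsum_cond (W : lmodType 'F_2) (T : finType) (phi : T -> W)
    (A : {set T}) (s : seq T) : uniq s -> {subset A <= s} ->
  vsum phi A = \sum_(x <- s) (if x \in A then phi x else 0).
Proof.
move=> us As; rewrite -big_mkcond /vsum -[LHS]big_filter -[RHS]big_filter; 
apply/perm_big/uniq_perm.
- by rewrite filter_uniq // /index_enum -enumT enum_uniq.
- exact: filter_uniq.
move=> x; rewrite !mem_filter mem_index_enum andbT.
by apply/idP/andP => [xA|[]//]; rewrite xA As.
Qed.

(** Independence of a triple does not depend on the representation, so [indep3] can be carried from
    one representation of a matroid to another. *)
Lemma rep_indep3 (W : lmodType 'F_2) (T : finType) (M : matroid T)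
    (phi : T -> W) (K : {pred W}) x y z :
  add_closed K -> represents M phi K -> uniq [:: x; y; z] ->
  x \in ground M -> y \in ground M -> z \in ground M ->
  [set x; y; z] \in indeps M <-> indep3 phi K x y z.
Proof.
move=> cK rM u3 xM yM zM.
have sumE (A : {set T}) : A \subset [set x; y; z] -> vsum phi A =
    (if x \in A then phi x else 0) + ((if y \in A then phi y else 0) +
    ((if z \in A then phi z else 0) + 0)).
  move=> A3; rewrite (@vsum_cond _ _ phi A [:: x; y; z] u3) ?big_cons ?big_nil //.
  by move=> t /(subsetP A3); rewrite !inE -orbA.
have [xy xz yz] : [/\ x != y, x != z & y != z].
  by move: u3; rewrite /= !inE negb_or => /andP[/andP[-> ->] /andP[-> _]].
split=> [/rM[_ i3]|[[xK yK zK] [xyK xzK yzK xyzK]]]; last first.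
  apply/rM; split; first by rewrite !subUset !sub1set xM yM zM.
  move=> A A3; rewrite (sumE A A3) => AK; apply/setP => t; rewrite inE.
  apply/negP => tA; have := subsetP A3 t tA; rewrite !inE => tE.
  move: AK; have [xA|xA] := boolP (x \in A); have [yA|yA] := boolP (y \in A);
    have [zA|zA] := boolP (z \in A); rewrite ?addr0 ?add0r ?addrA => sK;
    try by [rewrite sK in xK | rewrite sK in yK | rewrite sK in zK
      | rewrite sK in xyK | rewrite sK in xzK | rewrite sK in yzK
      | rewrite sK in xyzK].
  by case/orP: tE => [/orP[]|] /eqP tE; rewrite -tE tA in xA yA zA.
have nK (A : {set T}) t : t \in A -> A \subset [set x; y; z] ->
    vsum phi A \notin K.
  by move=> tA A3; apply/negP => /(i3 A A3) A0; rewrite A0 inE in tA.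
have sub (t u v : T) : t \in [:: x; y; z] -> u \in [:: x; y; z] ->
    v \in [:: x; y; z] -> [set t; u; v] \subset [set x; y; z].
  by rewrite !inE !subUset !sub1set !inE -!orbA => -> -> ->.
have one t : t \in [:: x; y; z] -> phi t \notin K.
  move=> t3; rewrite -vsum1; apply: (@nK _ t); rewrite ?inE //.
  by have := sub t t t t3 t3 t3; rewrite !setUid.
have two t u : t != u -> t \in [:: x; y; z] -> u \in [:: x; y; z] ->
    phi t + phi u \notin K.
  move=> tu t3 u3'; rewrite -(vsum1 phi u) -vsumU1 ?inE //.
  apply: (@nK _ t); rewrite ?inE ?eqxx //.
  by have := sub t t u t3 t3 u3'; rewrite setUid.
split; first by split; apply: one; rewrite !inE eqxx ?orbT.
split; try (by apply: two; rewrite ?inE ?eqxx ?orbT).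
rewrite -addrA -(vsum1 phi z) -vsumU1 ?inE // -vsumU1 ?inE ?negb_or ?xy //.
by rewrite setUA; apply: (@nK _ x); rewrite ?inE ?eqxx.
Qed.

Lemma edge_vec2 (V : finType) (x y : V) : x != y ->
  edge_vec [set x; y] = edge_vec [set x] + edge_vec [set y].
Proof.
move=> xy; rewrite -edge_vec_symdiff; congr edge_vec.
apply/setP => z; rewrite !inE; have [->|] := eqVneq z x.
  by rewrite (negPf xy).
by case: (z == y).
Qed.

(* In C4 and in K4 with an edge deleted, the vertices can be numbered so that *)
(* i j k l is a 4-cycle and i, k are not adjacent.                            *)
Lemma cycle4_chords (W : lmodType 'F_2) (T V : finType) (N : matroid T)
    (phi : T -> W) (K : {pred W}) (G : sgraph V) (i j k l : V) :
  uniq [:: i; j; k; l] ->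
  [/\ adj G i j, adj G j k, adj G k l, adj G l i & ~~ adj G i k] ->
  add_closed K -> represents N phi K -> isomorphic N (cycle_matroid G) ->
  exists a b c d, [/\ a \in ground N, b \in ground N, c \in ground N &
      d \in ground N] /\
    [/\ indep3 phi K a b c, phi a + phi d \notin K, phi d \notin K,
        phi a + phi b + phi c + phi d \in K &
        {in ground N, forall y, phi a + phi b + phi y \notin K /\
                                phi a + phi c + phi y \notin K}].
Proof.
move=> u4 [ij jk kl li nik] cK rN isoN.
set ev := @edge_vec V.
have cK0 := F2span_closed ev set0.
have [psi [rpsi injpsi psiG Gpsi]] := isomorphic_rep cK0 isoN (rep_edge_vec G).
have {}injpsi : {in ground N &, injective psi}.
  by apply: injpsi => e f _ _; apply: edge_vec_inj.
have in0 w : (w \in F2span ev set0) = (w == 0) by rewrite F2span0.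
have [nij nik' nil njk [njl nkl]] :
    [/\ i != j, i != k, i != l, j != k & j != l /\ k != l].
  by move: u4; rewrite /= !inE !negb_or -!andbA => /and5P[-> -> -> -> /and3P[]].
have ev_neq0 (e : {set V}) x : x \in e -> ev e != 0.
  by move=> xe; rewrite edge_vec_eq0; apply/set0Pn; exists x.
have psi_edge y : y \in ground N -> exists2 e, e \in edges G & psi y = ev e.
  by move=> /psiG[e eG ye]; exists e.
have psi0 y : y \in ground N -> psi y != 0.
  move=> /psi_edge[e eG ->]; rewrite edge_vec_eq0 -cards_eq0.
  by rewrite (edge_card2 eG).
(* [N] has two representations: [psi] by edge vectors, through the isomorphism, and [phi] modulo
   [K]. Independent triples pass from the first to the second. *)
have ind x y z : x \in ground N -> y \in ground N -> z \in ground N ->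
    x != y -> x != z -> y != z -> psi x + psi y + psi z != 0 ->
    indep3 phi K x y z.
  move=> xN yN zN xy xz yz xyz.
  have u3 : uniq [:: x; y; z] by rewrite /= !inE negb_or xy xz yz.
  apply/(rep_indep3 cK rN u3 xN yN zN)/(rep_indep3 cK0 rpsi u3 xN yN zN).
  rewrite /indep3 !in0; split; first by split; apply: psi0.
  by split=> //; rewrite addv_eq0 (inj_in_eq injpsi).
rewrite -!edgeE in ij jk kl li nik.
have [a aN pa] := Gpsi _ ij; have [b bN pb] := Gpsi _ jk.
have [c cN pc] := Gpsi _ kl; have [d dN pd] := Gpsi _ li.
move: pa pb pc pd; rewrite !edge_vec2 // 1?eq_sym //.
rewrite -!/ev; set di := ev [set i]; set dj := ev [set j].
set dk := ev [set k]; set dl := ev [set l] => pa pb pc pd.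
have evik : ev [set i; k] = di + dk by apply: edge_vec2.
have evjl : ev [set j; l] = dj + dl by apply: edge_vec2.
have evall : ev (symdiff [set i; j] [set k; l]) = di + dj + dk + dl.
  by rewrite /ev edge_vec_symdiff !edge_vec2 // addrA.
have sik : di + dk != 0 by rewrite -evik (ev_neq0 _ i) // !inE eqxx.
have sjl : dj + dl != 0 by rewrite -evjl (ev_neq0 _ j) // !inE eqxx.
have sall : di + dj + dk + dl != 0.
  rewrite -evall (ev_neq0 _ i) // !inE eqxx.
  by rewrite (negPf nik') (negPf nil).
have neq x y w : psi x + psi y = w -> w != 0 -> x != y.
  by move=> <-; apply: contraNneq => ->; rewrite addv2.
have ab : a != b by apply: neq sik; rewrite pa pb; char2.
have ac : a != c by apply: neq sall; rewrite pa pc; char2.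
have ad : a != d by apply: neq sjl; rewrite pa pd; char2.
have bc : b != c by apply: neq sjl; rewrite pb pc; char2.
have bd : b != d by apply: neq sall; rewrite pb pd; char2.
have cd : c != d by apply: neq sik; rewrite pc pd; char2.
(* The sum of [a] and [b] is the non-adjacent pair [i], [k], and the sum of [a] and [c] has all four
   vertices in its support; neither is an edge. *)
have aby y : y \in ground N -> psi a + psi b + psi y != 0.
  move=> /psi_edge[e eG ->]; rewrite addv_eq0.
  rewrite (_ : _ + _ = ev [set i; k]); last by rewrite evik pa pb; char2.
  by apply: contra nik => /eqP/edge_vec_inj->.
have acy y : y \in ground N -> psi a + psi c + psi y != 0.
  move=> /psi_edge[e eG ->]; rewrite addv_eq0.
  rewrite (_ : _ + _ = ev (symdiff [set i; j] [set k; l])); last first.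
    by rewrite evall pa pc; char2.
  apply/eqP => /edge_vec_inj ee; have := edge_card2 eG; rewrite -ee.
  have ijk : [set i; j; k] \subset symdiff [set i; j] [set k; l].
    rewrite !subUset !sub1set !inE !eqxx ?orbT /= (eq_sym k i) (eq_sym k j).
    by rewrite (negPf nik') (negPf nil) (negPf njk) (negPf njl).
  move=> e2; have := subset_leq_card ijk; rewrite e2 setUC cardsU1 cards2.
  by rewrite !inE nij (eq_sym k i) (eq_sym k j) (negPf nik') (negPf njk).
have abc : indep3 phi K a b c by apply: ind => //; apply: aby.
have abd : indep3 phi K a b d by apply: ind => //; apply: aby.
have acd : indep3 phi K a c d by apply: ind => //; apply: acy.
have bcd : indep3 phi K b c d.
  apply: ind => //; rewrite pb pc pd (_ : _ + _ = psi a) ?psi0 //.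
  by rewrite pa; char2.
exists a, b, c, d; split=> //.
have [[[aK bK cK'] [abK acK bcK abcK]] [[_ _ dK] [_ adK bdK abdK]]] := (abc, abd).
have [[[_ _ _] [_ _ cdK acdK]] [_ [_ _ _ bcdK]]] := (acd, bcd).
split=> // [|y yN]; last first.
  split.
    have [->|ya] := eqVneq y a.
      by rewrite (_ : _ + _ = phi b) //; char2.
    have [->|yb] := eqVneq y b.
      by rewrite (_ : _ + _ = phi a) //; char2.
    by have [_ []] : indep3 phi K a b y 
      by apply: ind; [| | | | rewrite eq_sym | rewrite eq_sym | apply: aby].
  have [->|ya] := eqVneq y a.
    by rewrite (_ : _ + _ = phi c) //; char2.
  have [->|yc] := eqVneq y c.
    by rewrite (_ : _ + _ = phi a) //; char2.
  by have [_ []] : indep3 phi K a c y 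
      by apply: ind; [| | | | rewrite eq_sym | rewrite eq_sym | apply: acy].
have u4' : uniq [:: a; b; c; d] by rewrite /= !inE !negb_or ab ac ad bc bd cd.
(* The four edges sum to zero under [psi], so [D] is dependent in [N] and some nonempty subset has
   its [phi]-sum in [K]; the independent triples leave only [D] itself. *)
pose D := [set x in [:: a; b; c; d]].
have DN : D \subset ground N.
  by apply/subsetP => x; rewrite !inE => /or4P[] /eqP->.
have Ds (A : {set T}) : A \subset D -> {subset A <= [:: a; b; c; d]}.
  by move=> AD x /(subsetP AD); rewrite inE.
have Ddep : D \notin indeps N.
  apply: (rep_dep rpsi DN); first by apply/set0Pn; exists a; rewrite !inE eqxx.
  rewrite (vsum_cond psi u4' (Ds D (subxx _))) !big_cons big_nil !inE !eqxx ?orbT.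
  rewrite pa pb pc pd (_ : _ + _ = 0); first by case: cK0.
  by char2.
have [B [BD B0 BK]] := rep_depP rN DN Ddep.
move: BK; rewrite (vsum_cond phi u4' (Ds B BD)) !big_cons big_nil.
have [aB|aB] := boolP (a \in B); have [bB|bB] := boolP (b \in B);
  have [cB|cB] := boolP (c \in B); have [dB|dB] := boolP (d \in B);
  rewrite ?addr0 ?add0r ?addrA => sK; try by [];
  try by [rewrite sK in aK | rewrite sK in bK | rewrite sK in cK'
    | rewrite sK in dK | rewrite sK in abK | rewrite sK in acK
    | rewrite sK in adK | rewrite sK in bcK | rewrite sK in bdK
    | rewrite sK in cdK | rewrite sK in abcK | rewrite sK in abdK
    | rewrite sK in acdK | rewrite sK in bcdK].
case/set0Pn: B0 => x xB; have := Ds B BD x xB.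
by rewrite !inE => /or4P[] /eqP xE; rewrite -xE xB in aB bB cB dB.
Qed.

(** The chord given by [M] lies in [U] and is not a loop modulo [X], so it is parallel to an element
    of the minor, where [cycle4_chords] forbids it. *)
Lemma has_chords_no_cycle4 (W : lmodType 'F_2) (T V : finType) (M : matroid T)
    (phi : T -> W) (G : sgraph V) (i j k l : V) :
  uniq [:: i; j; k; l] ->
  [/\ adj G i j, adj G j k, adj G k l, adj G l i & ~~ adj G i k] ->
  represents M phi (F2span phi set0) -> has_chords M phi ->
  ~ has_induced_minor M (cycle_matroid G).
Proof.
move=> u4 Gc rM chM [N mN isoN].
have [X [U [[XM cU NM rN] [XU NU MU]]]] := induced_minor_shape rM mN.
have cK := F2span_closed phi X.
have [a [b [c [d [[aN bN cN dN] [i3 adK dK sK yK]]]]]] :=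
  cycle4_chords u4 Gc cK rN isoN.
have [[aK bK cK'] [abK acK _ _]] := i3.
have KU : {subset F2span phi X <= U} by apply: sub_F2span.
have key x u : x \in ground M -> u \in ground N -> phi a + phi u \notin F2span phi X ->
    phi a + phi u + phi x \in F2span phi X ->
    exists2 y, y \in ground N & phi a + phi u + phi y \in F2span phi X.
  move=> xM uN auK auxK; have [||y yN xy] := MU x xM.
  - have := KU _ auxK; rewrite closed_addl //.
    by apply: closedD => //; apply: NU.
  - by apply: contra auK => xK; rewrite -(closed_addr _ cK xK).
  by exists y => //; apply: closed_trans auxK xy.
have [x xM] := chM X a b c d XM (subsetP NM a aN) (subsetP NM b bN)
  (subsetP NM c cN) (subsetP NM d dN) sK (And4 aK bK cK' dK)
  (And3 abK acK adK).
case/orP=> /(key x _ xM) [] // y yN; have [ab ac] := yK y yN.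
  by rewrite (negPf ab).
by rewrite (negPf ac).
Qed.

Lemma has_chords_no_minor (W : lmodType 'F_2) (T : finType) (M : matroid T)
    (phi : T -> W) :
  represents M phi (F2span phi set0) -> has_chords M phi ->
  ~ has_induced_minor M (cycle_matroid C4) /\
  ~ has_induced_minor M (cycle_matroid K4_minus_edge).
Proof.
pose v (n : nat) : 'I_4 := inord n.
have vE n m : (n < 4)%N -> (m < 4)%N -> (v n == v m) = (n == m).
  by move=> n4 m4; rewrite -val_eqE /= !inordK.
move=> rM cM; split.
  apply: (has_chords_no_cycle4 (i := v 0) (j := v 1) (k := v 2) (l := v 3)) rM cM.
    by rewrite /= !inE !vE.
  by rewrite /= /cycle_adj -!val_eqE /= !inordK.
have v03 : [set ord0; ord_max] = [set v 0; v 3].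
  by congr [set _; _]; apply/val_inj; rewrite /= inordK.
have neq x y z : (z == x) || (z == y) -> z \notin [set v 0; v 3] ->
    [set x; y] != [set v 0; v 3].
  by move=> zxy; apply: contraNneq => <-; rewrite !inE.
(* The missing edge joins 0 and 3, which must be opposite vertices of the 4-cycle. *)
apply: (has_chords_no_cycle4 (i := v 0) (j := v 1) (k := v 3) (l := v 2)) rM cM.
  by rewrite /= !inE !vE.
rewrite /= /delete_edge_adj v03 eqxx andbF /= /complete_adj !vE //=.
split=> //; [apply: (neq _ _ (v 1))|apply: (neq _ _ (v 1))
            |apply: (neq _ _ (v 2))|apply: (neq _ _ (v 2))];
  by rewrite ?inE ?vE ?eqxx ?orbT.
Qed.

(** * Excluding both minors yields the chord property *)

Lemma edges_adj (V : finType) (G : sgraph V) (e : {set V}) : e \in edges G ->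
  exists x y, adj G x y /\ e = [set x; y].
Proof. by case/imsetP=> [[x y]]; rewrite inE /= => xy ->; exists x, y. Qed.

Lemma isomorphic_cycle (W : lmodType 'F_2) (T V : finType) (N : matroid T)
    (phi : T -> W) (K : {pred W}) (G : sgraph V) (d : V -> W) :
  add_closed K -> represents N phi K ->
  {in ground N &, forall x y, phi x + phi y \in K -> x = y} ->
  (forall B : {set V}, ~~ odd #|B| -> vsum d B \in K -> B = set0) ->
  {in ground N, forall x, exists i j, adj G i j /\ phi x + (d i + d j) \in K} ->
  (forall i j, adj G i j -> exists2 x, x \in ground N & phi x + (d i + d j) \in K) ->
  isomorphic N (cycle_matroid G).
Proof.
move=> cK rN injN dK NG GN.
have dE i j : adj G i j -> vsum d [set i; j] = d i + d j.
  move=> ij; rewrite vsumU1 ?vsum1 // inE; apply: contraTneq ij => ->.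
  by rewrite adj_irrefl.
have rG := rep_cycle G dK cK.
apply: (rep_isomorphic cK rN rG injN) => [e f eG fG|x xN|e].
- rewrite -vsum_symdiff => /dK ef; apply/eqP; rewrite -symdiff_eq0 ef //.
  by rewrite odd_symdiff (edge_card2 eG) (edge_card2 fG).
- have [i [j [ij xij]]] := NG x xN.
  by exists [set i; j]; rewrite /= ?edgeE // dE.
- case/edges_adj=> i [j [ij ->]]; have [x xN xij] := GN i j ij.
  by exists x; rewrite // dE.
Qed.

(* The edge ij of a graph on four vertices is represented by the sum of the   *)
(* vectors attached to its ends i and j.                                      *)
Definition tetrad (W : lmodType 'F_2) (p q r : W) (i : 'I_4) : W :=
  [:: 0; p; q; r]`_i.

(** The vertex with vector 0 can correct any parity, so the even sets of vertices correspond to the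
    subsets of [p, q, r], which are independent modulo [K]. *)
Lemma tetrad_even (W : lmodType 'F_2) (K : {pred W}) (p q r : W)
    (B : {set 'I_4}) :
  [/\ p \notin K, q \notin K & r \notin K] ->
  [/\ p + q \notin K, p + r \notin K, q + r \notin K & p + q + r \notin K] ->
  ~~ odd #|B| -> vsum (tetrad p q r) B \in K -> B = set0.
Proof.
move=> [pK qK rK] [pqK prK qrK pqrK].
pose o0 : 'I_4 := Ordinal (isT : 0 < 4)%N.
pose o1 : 'I_4 := Ordinal (isT : 1 < 4)%N.
pose o2 : 'I_4 := Ordinal (isT : 2 < 4)%N.
pose o3 : 'I_4 := Ordinal (isT : 3 < 4)%N.
pose s := [:: o0; o1; o2; o3].
have s_all i : i \in s by case: i => -[|[|[|[|//]]]] ?.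
have us : uniq s by [].
have -> : #|B| = size [seq i <- s | i \in B].
  rewrite -(card_uniqP (filter_uniq _ us)); apply: eq_card => i.
  by rewrite mem_filter s_all andbT.
rewrite (vsum_cond (tetrad p q r) us) // size_filter /= !big_cons big_nil.
rewrite /tetrad /= addr0.
have [B0|B0] := boolP (o0 \in B); have [B1|B1] := boolP (o1 \in B);
  have [B2|B2] := boolP (o2 \in B); have [B3|B3] := boolP (o3 \in B);
  rewrite ?addr0 ?add0r ?addrA //= => _ sK;
  try by [rewrite sK in pK | rewrite sK in qK | rewrite sK in rK
    | rewrite sK in pqK | rewrite sK in prK | rewrite sK in qrK
    | rewrite sK in pqrK].
apply/setP => i; rewrite inE; apply/negP => iB.
by have := s_all i; rewrite !inE => /or4P[] /eqP iE; rewrite -iE iB in B0 B1 B2 B3.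
Qed.

(** Given a 4-circuit with neither of the two chords, one contracts [X], simplifies, and restricts
    to the flat spanned by the circuit. What remains is the 4-circuit, or the 4-circuit with the
    chord [a + d]. *)
Lemma no_minor_has_chords (W : lmodType 'F_2) (T : finType) (M : matroid T)
    (phi : T -> W) :
  represents M phi (F2span phi set0) ->
  ~ has_induced_minor M (cycle_matroid C4) ->
  ~ has_induced_minor M (cycle_matroid K4_minus_edge) -> has_chords M phi.
Proof.
move=> rM nC4 nK4 X a b c d K XM aM bM cM dM sK [aK bK cK' dK] [abK acK adK].
have cK : add_closed K by apply: F2span_closed.
have [/existsP[x /andP[xM xK]]|/existsPn nchord] := boolP [exists x,
    (x \in ground M) &&
    ((phi a + phi b + phi x \in K) || (phi a + phi c + phi x \in K))].
  by exists x.
exfalso; have K0 : 0 \in K by case: cK.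
have inK u w : u \in K -> w = u -> w \in K by move=> uK ->.
have rN1 : represents (contract M X) phi K.
  by have := rep_contract XM rM; rewrite set0U.
have [S sS] := simplifying_set_exists cK rN1.
have [SN1 Sl S1] := sS.
pose N2 := restrict (contract M X) S.
have mN2 : induced_minor M N2.
  by apply: induced_minor_contract sS => //; apply: induced_minor_refl.
have rN2 : represents N2 phi K by apply: rep_restrict.
pose U := F2span phi (X :|: [set a; b; c]).
have cU : add_closed U by apply: F2span_closed.
have KU : {subset K <= U} by apply: F2spanS; apply: subsetUl.
have fF := flat_closed rN2 cU KU; set F := finset _ in fF.
pose N3 := restrict N2 F.
have mN3 : induced_minor M N3 by apply: induced_minor_flat.
have rN3 : represents N3 phi K by apply: rep_restrict.
have N3P y : y \in ground N3 ->
    [/\ y \in S, y \in ground (contract M X), y \in ground M,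
        phi y \notin K & phi y \in U].
  case/setIP=> /setIP[yN1 yS]; rewrite in_set => /andP[_ yU].
  have yM : y \in ground M by case/setDP: yN1.
  by split=> //; rewrite -(loopE rN1) // Sl.
have injN3 : {in ground N3 &, forall x y, phi x + phi y \in K -> x = y}.
  move=> x y /N3P[xS xN1 _ xK _] /N3P[yS yN1 _ yK _] xyK.
  have /eqP/cards1P[z /setP zE] := S1 x xN1 (Sl x xS).
  have := zE x; have := zE y; rewrite !inE xS yS eqxx /= => yz /esym/eqP->.
  apply/esym/eqP; rewrite -yz; have [//|yx] := eqVneq y x.
  by apply/(parallelP rN1); rewrite eq_sym.
have N3rep x : x \in ground M -> phi x \notin K -> phi x \in U ->
    exists2 y, y \in ground N3 & phi x + phi y \in K.
  move=> xM xK xU; have xX : x \notin X.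
    by apply: contra xK => xX; apply: mem_F2span.
  have xN1 : x \in ground (contract M X) by rewrite /= inE xX.
  have := S1 x xN1; rewrite (loopE rN1) // => /(_ xK)/eqP/cards1P[z /setP/(_ z)].
  rewrite !inE eqxx => /andP[zS xz]; have zN1 := subsetP SN1 z zS.
  have {}xz : phi x + phi z \in K.
    case/orP: xz => [/eqP->|/(parallelP rN1)[_ _ _ _ []//]].
    by rewrite addv2; case: cK.
  exists z => //; have zU : phi z \in U by rewrite -(closed_addl _ cU xU) KU.
  have zN2 : z \in ground N2 by apply/setIP.
  by apply/setIP; split=> //; rewrite in_set zN2.
have memU x : x \in [set a; b; c] -> phi x \in U.
  by move=> x3; apply: mem_F2span; rewrite inE x3 orbT.
have aU : phi a \in U by apply: memU; rewrite !inE eqxx.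
have bU : phi b \in U by apply: memU; rewrite !inE eqxx orbT.
have cU' : phi c \in U by apply: memU; rewrite !inE eqxx !orbT.
have dU : phi d \in U.
  by have := KU _ sK; rewrite closed_addl //; do 2?apply: closedD.
have [a' aN aa] := N3rep a aM aK aU; have [b' bN bb] := N3rep b bM bK bU.
have [c' cN cc] := N3rep c cM cK' cU'; have [d' dN dd] := N3rep d dM dK dU.
(* Of the seven nonzero classes spanned by [a, b, c] modulo [K], those of [a + b] and [a + c] are
   excluded; [a + b + c] is the class of [d], and [b + c] that of [a + d]. *)
have class y : y \in ground N3 ->
    [\/ phi y + phi a \in K, phi y + phi b \in K, phi y + phi c \in K |
        phi y + phi d \in K] \/ phi a + phi d + phi y \in K.
  move=> /N3P[_ _ yM yK /F2spanU[A A3]]; rewrite -/K => yA.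
  have /negP := nchord y; rewrite yM /= => /negP; rewrite negb_or => /andP[yab yac].
  have neq u w : phi u + phi w \notin K -> u != w.
    by apply: contraNneq => ->; rewrite addv2.
  have u3 : uniq [:: a; b; c].
    rewrite /= !inE negb_or !neq //.
    by apply: contra adK => bcK; apply: inK (closedD cK bcK sK) _; char2.
  move: yA; rewrite (vsum_cond phi u3) ?big_cons ?big_nil; last first.
    by move=> x /(subsetP A3); rewrite !inE -orbA.
  rewrite addr0; case: (a \in A); case: (b \in A); case: (c \in A);
    rewrite ?addr0 ?add0r => yA.
  - by left; apply: Or44; apply: inK (closedD cK yA sK) _; char2.
  - by case/negP: yab; apply: inK yA _; char2.
  - by case/negP: yac; apply: inK yA _; char2.
  - by left; apply: Or41.
  - by right; apply: inK (closedD cK yA sK) _; char2.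
  - by left; apply: Or42.
  - by left; apply: Or43.
  - by rewrite yA in yK.
have notK u w : u \notin K -> u + w \in K -> w \notin K.
  by move=> uK uwK; apply: contra uK => wK; rewrite -(closed_addr _ cK wK).
have pK : phi a + phi b + phi d \notin K.
  by apply: (notK _ _ cK'); apply: inK sK _; char2.
have qK : phi b + phi d \notin K.
  by apply: (notK _ _ acK); apply: inK sK _; char2.
have hit u w w' : w' \in ground N3 -> phi w + phi w' \in K -> phi w + u \in K ->
    exists2 x, x \in ground N3 & phi x + u \in K.
  move=> wN ww wu; exists w' => //; apply: closed_trans wu => //.
  by rewrite addrC.
pose o0 : 'I_4 := Ordinal (isT : 0 < 4)%N.
pose o1 : 'I_4 := Ordinal (isT : 1 < 4)%N.
pose o2 : 'I_4 := Ordinal (isT : 2 < 4)%N.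
pose o3 : 'I_4 := Ordinal (isT : 3 < 4)%N.
have [/existsP[e /andP[eM eK]]|/existsPn nchord'] :=
    boolP [exists x, (x \in ground M) && (phi a + phi d + phi x \in K)].
  apply: nK4; exists N3 => //.
  have eK' : phi e \notin K by apply: notK eK.
  have eU : phi e \in U.
    by have := KU _ eK; rewrite closed_addl //; apply: closedD.
  have [e' eN ee] := N3rep e eM eK' eU.
  (* With vertex vectors 0, [a], [d], [a + b], the edges 01, 13, 23, 02 are [a, b, c, d], the edge
     12 is the chord, and the deleted edge 03 would be [a + b]. *)
  pose t := tetrad (phi a) (phi d) (phi a + phi b).
  have adjE i j : i \notin [set ord0; ord_max] -> i != j ->
      adj K4_minus_edge i j /\ adj K4_minus_edge j i.
    move=> i03 ij; suff aij : adj K4_minus_edge i j.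
      by split; [|rewrite adj_sym].
    rewrite /= /delete_edge_adj /= /complete_adj ij /=.
    by apply: contraNneq i03 => <-; rewrite !inE eqxx.
  have [a01 a10] : adj K4_minus_edge o1 o0 /\ adj K4_minus_edge o0 o1.
    by apply: adjE; rewrite ?inE.
  have [a13 _] : adj K4_minus_edge o1 o3 /\ adj K4_minus_edge o3 o1.
    by apply: adjE; rewrite ?inE.
  have [a12 _] : adj K4_minus_edge o1 o2 /\ adj K4_minus_edge o2 o1.
    by apply: adjE; rewrite ?inE.
  have [a20 _] : adj K4_minus_edge o2 o0 /\ adj K4_minus_edge o0 o2.
    by apply: adjE; rewrite ?inE.
  have [a23 _] : adj K4_minus_edge o2 o3 /\ adj K4_minus_edge o3 o2.
    by apply: adjE; rewrite ?inE.
  apply: (isomorphic_cycle (d := t) cK rN3 injN3) => [B oB|y yN|].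
  - apply: tetrad_even oB => //.
    split=> //.
    + by apply: contra bK => h; apply: inK h _; char2.
    + by apply: contra pK => h; apply: inK h _; char2.
    + by apply: contra qK => h; apply: inK h _; char2.
  - case: (class y yN) => [[]|] yK.
    + by exists o1, o0; split=> //; apply: inK yK _; rewrite /t /tetrad /=; char2.
    + by exists o1, o3; split=> //; apply: inK yK _; rewrite /t /tetrad /=; char2.
    + exists o2, o3; split=> //; apply: inK (closedD cK yK sK) _.
      by rewrite /t /tetrad /=; char2.
    + by exists o2, o0; split=> //; apply: inK yK _; rewrite /t /tetrad /=; char2.
    + by exists o1, o2; split=> //; apply: inK yK _; rewrite /t /tetrad /=; char2.
  have n03 (p : (0 < 4)%N) (q : (3 < 4)%N) : [set Ordinal p; Ordinal q] =
      [set ord0; ord_max] :> {set 'I_4} by congr [set _; _]; apply/val_inj.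
  case=> [[|[|[|[|//]]]] ip] [[|[|[|[|//]]]] jp]; rewrite /= /delete_edge_adj /=
    ?n03 ?[[set Ordinal ip; Ordinal jp]]setUC ?n03 ?eqxx ?andbF //;
    move=> _; rewrite /t /tetrad /=;
    first [ by apply: (hit _ _ _ aN aa); apply: inK K0 _; char2
          | by apply: (hit _ _ _ bN bb); apply: inK K0 _; char2
          | by apply: (hit _ _ _ cN cc); apply: inK sK _; char2
          | by apply: (hit _ _ _ dN dd); apply: inK K0 _; char2
          | by apply: (hit _ _ _ eN ee); apply: inK eK _; char2].
apply: nC4; exists N3 => //.
(* With vertex vectors 0, [a], [a + b], [d], the 4-cycle 0, 1, 2, 3 has the edges [a, b, c, d]. *)
pose t := tetrad (phi a) (phi a + phi b) (phi d).
apply: (isomorphic_cycle (d := t) cK rN3 injN3) => [B oB|y yN|].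
- apply: tetrad_even oB => //; split=> //.
  + by apply: contra bK => h; apply: inK h _; char2.
  + by apply: contra qK => h; apply: inK h _; char2.
- case: (class y yN) => [[]|] yK.
  + by exists o0, o1; split=> //; apply: inK yK _; rewrite /t /tetrad /=; char2.
  + by exists o1, o2; split=> //; apply: inK yK _; rewrite /t /tetrad /=; char2.
  + exists o2, o3; split=> //; apply: inK (closedD cK yK sK) _.
    by rewrite /t /tetrad /=; char2.
  + by exists o3, o0; split=> //; apply: inK yK _; rewrite /t /tetrad /=; char2.
  + have [_ _ yM _ _] := N3P y yN; by have := nchord' y; rewrite yM yK.
case=> [[|[|[|[|//]]]] ip] [[|[|[|[|//]]]] jp] //= _; rewrite /t /tetrad /=;
  first [ by apply: (hit _ _ _ aN aa); apply: inK K0 _; char2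
        | by apply: (hit _ _ _ bN bb); apply: inK K0 _; char2
        | by apply: (hit _ _ _ cN cc); apply: inK sK _; char2
        | by apply: (hit _ _ _ dN dd); apply: inK K0 _; char2].
Qed.

(** * Sets of vectors with the chord property *)

Section Structure.

Variables (W : finLmodType 'F_2) (E : {set W}).
Implicit Types (A B C D F J L U : {set W}) (a b c d u v w x y z : W).

Local Notation sum := (vsum (@id W)).

Definition vfree L : Prop := forall A, A \subset L -> sum A = 0 -> A = set0.

(** The chord property for the circuit formed by [L] and [sum L], when all of [L] but [a, b, c] is
    contracted: [sum L] is the fourth element of the 4-circuit, and [J] expresses that the chord is
    only determined modulo the contraction. *)
Definition chordal : Prop := forall L a b c,
  L \subset E -> vfree L -> sum L \in E ->
  a \in L -> b \in L -> c \in L -> uniq [:: a; b; c] ->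
  exists2 J : {set W}, J \subset L :\: [set a; b; c] &
    (a + b + sum J \in E) || (a + c + sum J \in E).

Definition vconnected : Prop := forall x y, x \in E -> y \in E -> x != y ->
  exists C, [/\ C \subset E, x \in C, y \in C, sum C = 0 &
    forall A, A \subset C -> sum A = 0 -> A = set0 \/ A = C].

Lemma vfreeS A B : vfree B -> A \subset B -> vfree A.
Proof. by move=> fB AB C CA; apply: fB; apply: subset_trans AB. Qed.

Lemma vfree_inj L A B : vfree L -> A \subset L -> B \subset L ->
  sum A = sum B -> A = B.
Proof.
move=> fL AL BL AB; apply/eqP; rewrite -symdiff_eq0; apply/eqP/fL.
  exact: symdiff_sub.
by rewrite vsum_symdiff AB addv2.
Qed.

Lemma sum_set3 a b c : uniq [:: a; b; c] -> sum [set a; b; c] = a + b + c.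
Proof.
rewrite /= !inE negb_or => /and3P[/andP[ab ac] bc _].
by rewrite -setUA vsumU1 ?inE ?negb_or ?ab // vsumU1 ?inE // vsum1 addrA.
Qed.

Lemma vfree3 a b c : [/\ a != 0, b != 0 & c != 0] -> uniq [:: a; b; c] ->
  a + b + c != 0 -> vfree [set a; b; c].
Proof.
move=> [a0 b0 c0] u3 abc A A3.
have sA : {subset A <= [:: a; b; c]}.
  by move=> x /(subsetP A3); rewrite !inE -orbA.
rewrite (vsum_cond (@id W) u3 sA) !big_cons big_nil addr0.
move: u3; rewrite /= !inE negb_or => /and3P[/andP[ab ac] bc _].
have [aA|aA] := boolP (a \in A); have [bA|bA] := boolP (b \in A);
  have [cA|cA] := boolP (c \in A); rewrite ?addr0 ?add0r ?addrA => /eqP s0;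
  try by [rewrite s0 in a0 | rewrite s0 in b0 | rewrite s0 in c0
    | rewrite s0 in abc | rewrite addv_eq0 in s0; rewrite s0 in ab
    | rewrite addv_eq0 in s0; rewrite s0 in ac
    | rewrite addv_eq0 in s0; rewrite s0 in bc].
apply/setP => x; rewrite inE; apply/negP => xA.
by have := sA x xA; rewrite !inE => /or3P[] /eqP xE; rewrite -xE xA in aA bA cA.
Qed.

Hypotheses (E0 : 0 \notin E) (chE : chordal) (cE : vconnected).

Lemma neq0E x : x \in E -> x != 0.
Proof. by apply: contraTneq => ->. Qed.

(** The chord property with nothing contracted: [L] is [a, b, c] and [J] is empty. *)
Lemma four_circuit a b c : a \in E -> b \in E -> c \in E -> a + b + c \in E ->
  a != b -> a != c -> b != c -> (a + b \in E) || (a + c \in E).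
Proof.
move=> aE bE cE' abcE ab ac bc.
have u3 : uniq [:: a; b; c] by rewrite /= !inE negb_or ab ac bc.
have [||||||J] := chE (L := [set a; b; c]) (a := a) (b := b) (c := c) _ _ _ _ _ _ u3.
- by rewrite !subUset !sub1set aE bE cE'.
- by apply: vfree3; rewrite ?neq0E.
- by rewrite sum_set3.
- by rewrite !inE eqxx.
- by rewrite !inE eqxx orbT.
- by rewrite !inE eqxx orbT.
by rewrite setDv subset0 => /eqP->; rewrite vsum0 !addr0.
Qed.

Lemma size3 A : (2 < #|A|)%N -> exists a b c,
  [/\ a \in A, b \in A, c \in A & uniq [:: a; b; c]].
Proof.
move=> A3; have [a aA] : exists a, a \in A by apply/card_gt0P/ltnW/ltnW.
move: A3; rewrite (cardsD1 a) aA ltnS => A2.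
have [b /setD1P[ba bA]] : exists b, b \in A :\ a by apply/card_gt0P/ltnW.
move: A2; rewrite (cardsD1 b) !inE ba bA ltnS => /card_gt0P[c].
rewrite !inE => /and3P[cb ca cA]; exists a, b, c; split=> //.
by rewrite /= !inE negb_or !(eq_sym a) ba ca eq_sym cb.
Qed.

(* A chord of a circuit meeting both F and its complement splits it into two  *)
(* smaller circuits, one of which still meets both; so a smallest such        *)
(* circuit is a triangle.                                                     *)
Lemma crossing_triangle F x y : x \in E -> y \in E -> x \in F -> y \notin F ->
  exists a b, [/\ a \in E, b \in E, a \in F, b \notin F & a + b \in E].
Proof.
move=> xE yE xF yF.
(* A circuit is presented as an independent [L] together with [sum L], and the induction is on the
   size of [L]. *)
have key n L : (#|L| < n)%N -> L \subset E -> vfree L -> sum L \in E ->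
    (exists2 u, u \in sum L |: L & u \in F) ->
    (exists2 w, w \in sum L |: L & w \notin F) ->
    exists a b, [/\ a \in E, b \in E, a \in F, b \notin F & a + b \in E].
  elim: n L => // n IH L; rewrite ltnS => Ln LE fL sL [u uL uF] [w wL wF].
  have [L3|L2] := ltnP 2 #|L|; last first.
    have uE : u \in E by case/setU1P: uL => [->//|/(subsetP LE)].
    have wE : w \in E by case/setU1P: wL => [->//|/(subsetP LE)].
    have uw : u != w by apply: contraNneq wF => <-.
    have L0 : L != set0 by apply: contraNneq E0 => L0; rewrite L0 vsum0 in sL.
    have [p pL] := set0Pn _ L0.
    have Lp : (#|L :\ p| <= 1)%N by move: L2; rewrite (cardsD1 p) pL.
    have [Lp0|[q qL]] := set_0Vmem (L :\ p).
      move: uL wL; rewrite (vsumD1 _ pL) Lp0 vsum0 addr0 /=.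
      have Lp1 : L = [set p] by rewrite -(setD1K pL) Lp0 setU0.
      by rewrite Lp1 setUid !inE => /eqP up /eqP wp; rewrite up wp eqxx in uw.
    have Lpq : L :\ p = [set q].
      by apply/eqP; rewrite eq_sym eqEcard sub1set qL cards1.
    have sE : sum L = p + q by rewrite (vsumD1 _ pL) Lpq vsum1.
    have [pE qE] : p \in E /\ q \in E.
      by split; apply: (subsetP LE) => //; case/setD1P: qL.
    have LE' : L = [set p; q] by rewrite -(setD1K pL) Lpq.
    exists u, w; split=> //; rewrite sE in sL.
    move: uL wL uw; rewrite sE LE' !inE.
    case/or3P=> /eqP-> /or3P[] /eqP->; rewrite ?eqxx // => _.
    - by rewrite (_ : _ + _ = q) //; char2.
    - by rewrite (_ : _ + _ = p) //; char2.
    - by rewrite (_ : _ + _ = q) //; char2.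
    - by rewrite (_ : _ + _ = p) //; char2.
    - by rewrite (_ : _ + _ = p + q) //; char2.
  (* The chord is the sum of a part [C1] of [L] which contains two of [a, b, c] and omits the third,
     so [C1] is neither a single element nor all of [L]. *)
  have [C1 [C1L C1E [z zL zC1] C1c]] : exists C1 : {set W},
      [/\ C1 \subset L, sum C1 \in E, exists2 z, z \in L & z \notin C1 &
          (1 < #|C1|)%N].
    have [a [b [c [aL bL cL u3]]]] := size3 L3.
    have [J JL ch] := chE LE fL sL aL bL cL u3.
    move: (u3); rewrite /= !inE negb_or => /and3P[/andP[ab ac] bc _].
    have build (p q r : W) : p \in L -> q \in L -> r \in L -> p != q ->
        r \notin [set p; q] -> [set p; q; r] = [set a; b; c] ->
        p + q + sum J \in E -> exists C1 : {set W}, [/\ C1 \subset L, sum C1 \in E,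
          exists2 z, z \in L & z \notin C1 & (1 < #|C1|)%N].
      move=> pL qL rL pq rpq abcE pqE; exists ([set p; q] :|: J).
      have dis : [disjoint [set p; q] & J].
        rewrite disjoint_sym disjoints_subset; apply/subsetP => t.
        move=> /(subsetP JL); rewrite -abcE !inE !negb_or.
        by case/andP=> /andP[/andP[-> ->]].
      split.
      - rewrite !subUset !sub1set pL qL /=; apply: subset_trans JL _.
        exact: subsetDl.
      - by rewrite vsumU // vsumU1 ?inE // vsum1.
      - exists r => //; rewrite inE negb_or rpq /=; apply/negP.
        by move/(subsetP JL); rewrite -abcE !inE eqxx orbT.
      - apply: leq_trans (subset_leq_card (subsetUl _ _)).
        by rewrite cards2 pq.
    case/orP: ch.
      by apply: (build a b c); rewrite // !inE !(eq_sym c) negb_or ac bc.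
    apply: (build a c b); rewrite // ?inE ?negb_or ?(eq_sym b a) ?ab ?bc //.
    by rewrite setUAC.
  set e := sum C1 in C1E *.
  have C1n : C1 != set0 by rewrite -card_gt0 ltnW.
  have eL : e \notin L.
    apply: contraL C1c => eL; suff -> : C1 = [set e] by rewrite cards1.
    by apply: (vfree_inj fL); rewrite ?sub1set // vsum1.
  (* The chord [e] splits the circuit into [e |: C1] and [sum L |: L2]. If [e] is in [F], the piece
     with the given point outside [F] meets both sides; otherwise it is the piece with the given
     point of [F]. *)
  pose L2 := e |: (L :\: C1).
  have eD : e \notin L :\: C1 by rewrite inE negb_and eL orbT.
  have sL2 : sum L2 = sum L.
    by rewrite vsumU1 // (vsumID _ L C1) (setIidPr C1L).
  have fL2 : vfree L2.
    move=> A AL2 A0; have [eA|eA] := boolP (e \in A); last first.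
      apply: fL A0; apply/subsetP => t tA; have := subsetP AL2 t tA.
      by rewrite !inE => /orP[/eqP tE|/andP[]//]; rewrite -tE tA in eA.
    have AD : A :\ e \subset L :\: C1 by rewrite subDset.
    case/eqP: C1n; have /eqP : C1 :|: A :\ e = set0.
      apply: fL.
        by rewrite subUset C1L (subset_trans AD) ?subsetDl.
      have AE := vsumD1 (@id W) eA.
      rewrite vsumU; first by transitivity (sum A).
      rewrite disjoint_sym disjoints_subset.
      by apply: subset_trans AD _; rewrite setDE subsetIr.
    by rewrite setU_eq0 => /andP[/eqP].
  have c1 : (#|C1| < n)%N.
    apply: leq_trans Ln; apply: proper_card; apply/properP; split=> //.
    by exists z.
  have c2 : (#|L2| < n)%N.
    apply: leq_trans Ln; rewrite cardsU1 eD add1n cardsD (setIidPr C1L).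
    by rewrite -[X in (_ < X)%N](subnK (subset_leq_card C1L)) -addn1 ltn_add2l.
  have IH1 := IH C1 c1 (subset_trans C1L LE) (vfreeS fL C1L) C1E.
  have L2E : L2 \subset E.
    by rewrite subUset sub1set C1E (subset_trans (subsetDl _ _)).
  have IH2 := IH L2 c2 L2E fL2; rewrite sL2 in IH2; have {}IH2 := IH2 sL.
  have split' t : t \in sum L |: L -> t \in e |: C1 \/ t \in sum L |: L2.
    rewrite !inE => /orP[->|tL]; first by right.
    by have [tC|tC] := boolP (t \in C1); [left|right]; rewrite ?tL ?orbT.
  have [eF|eF] := boolP (e \in F).
    case: (split' w wL) => [wC|wC]; [apply: IH1|apply: IH2].
    - by exists e; rewrite // !inE eqxx.
    - by exists w.
    - by exists e; rewrite // !inE eqxx orbT.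
    - by exists w.
  case: (split' u uL) => [uC|uC]; [apply: IH1|apply: IH2].
  - by exists u.
  - by exists e; rewrite // !inE eqxx.
  - by exists u.
  - by exists e; rewrite // !inE eqxx orbT.
have xy : x != y by apply: contraNneq yF => <-.
have [C [CE xC yC C0 Cm]] := cE xE yE xy.
have sx : sum (C :\ x) = x.
  by apply/eqP; rewrite -addv_eq0 addrC -(vsumD1 (@id W) xC) C0.
apply: (key #|C|.+1 (C :\ x)).
- by rewrite ltnS subset_leq_card // subsetDl.
- exact: subset_trans (subsetDl _ _) CE.
- move=> A AC A0; have AC' := subset_trans AC (subsetDl _ _).
  have [//|AE] := Cm A AC' A0.
  by move: (subsetP AC x); rewrite AE xC !inE eqxx => /(_ isT).
- by rewrite sx.
- by exists x; rewrite // sx !inE eqxx.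
- by exists y; rewrite // sx !inE yC andbT orbN.
Qed.

(** * Sets containing a Fano plane: projective subspaces *)

Definition projective U : Prop :=
  add_closed U /\ {in U, forall u, u != 0 -> u \in E}.

(** For a subspace [U], the span of [U] and [x]. *)
Definition extend U x := [set w | (w \in U) || (w + x \in U)].

Lemma extend_closed U x : add_closed U -> add_closed (extend U x).
Proof.
move=> [U0 UD]; split=> [|v w]; rewrite !inE ?U0 //.
case/orP=> vU /orP[] wU; apply/orP.
- by left; apply: UD.
- by right; rewrite -addrA; apply: UD.
- by right; rewrite addrAC; apply: UD.
- by left; rewrite (_ : v + w = v + x + (w + x)); [apply: UD|char2].
Qed.

Lemma avoid U (s : seq W) : (size s < #|U|)%N -> exists2 u, u \in U & u \notin s.
Proof.
move=> sU; have [/existsP[u /andP[uU us]]|/existsPn nU] :=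
  boolP [exists u, (u \in U) && (u \notin s)]; first by exists u.
move: sU; rewrite ltnNge; case/negP; apply: leq_trans (card_size s).
apply/subset_leq_card/subsetP => u uU; move: (nU u).
by rewrite uU /= negbK.
Qed.

Section Projective.

Variable U : {set W}.
Hypothesis pU : projective U.

Let cU : add_closed U := pU.1.
Let UE u : u \in U -> u != 0 -> u \in E. Proof. exact: pU.2. Qed.

(* If x + w and x + w' are in E but x + v is not, then the 4-circuit x + w,    *)
(* x + w', v + w, v + w' has the chord x + v + w + w'.                        *)
Lemma attached_missing x u b b' : x \in E -> x \notin U -> u \in U -> u != 0 ->
  x + u \in E -> b \in U -> b' \in U -> x + b \notin E -> x + b' \notin E ->
  b = b'.
Proof.
move=> xE xU uU u0 xuE bU b'U xb xb'; apply/eqP/negP => /negP bb'.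
have UD := closedD cU.
have key w w' v : w \in U -> w' \in U -> v \in U -> x + w \in E ->
    x + w' \in E -> w != w' -> x + v \notin E -> x + (v + w + w') \in E.
  move=> wU w'U vU xw xw' ww' xv.
  have vw : v + w != 0 by rewrite addv_eq0; apply: contraNneq xv => ->.
  have vw' : v + w' != 0 by rewrite addv_eq0; apply: contraNneq xv => ->.
  have nU t : t \in U -> x != t by move=> tU; apply: contraNneq xU => ->.
  have /orP[] : (x + w + (v + w) \in E) || (x + w + (v + w') \in E).
  - apply: four_circuit => //; try by apply: UE => //; apply: UD.
    + by rewrite (_ : _ + _ = x + w') //; char2.
    + by rewrite (inj_eq (addIr w)) nU.
    + rewrite -(inj_eq (addIr w)) (_ : x + w + w = x); last by char2.
      by apply/nU/UD => //; apply: UD.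
    + by rewrite (inj_eq (addrI v)).
  - by rewrite (_ : _ + _ = x + v) ?(negPf xv) //; char2.
  - by rewrite (_ : _ + _ = x + (v + w + w')) //; char2.
have x0E : x + 0 \in E by rewrite addr0.
(* Applied to the pairs [0, u], then [0, b + u], then [u, b' + b + u], with [v] equal to [b], [b']
   and [b], [key] ends at [x + b'] itself. *)
have U0 : 0 \in U by case: cU.
have bu : b + u != 0.
  by rewrite addv_eq0; apply: contraNneq xb => ->.
have xbu : x + (b + u) \in E.
  by rewrite -(addr0 b); apply: key; rewrite // eq_sym.
have xb'bu : x + (b' + (b + u)) \in E.
  by rewrite -(addr0 (b' + _)); apply: key; rewrite // UD.
suff : x + b' \in E by rewrite (negPf xb').
rewrite (_ : b' = b + u + (b' + (b + u))); last by char2.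
apply: (key u (b' + (b + u)) b) => //; first by rewrite !UD.
by apply: (addv_neq (z := b + b')); [char2|rewrite addv_eq0].
Qed.

(* The plane through the missing points x + bx, y + by_ and a suitable t in U *)
(* contains a 4-circuit of E with only one chord.                             *)
Lemma two_missing x y bx by_ : (7 < #|U|)%N -> x \notin U -> y \notin U ->
  x + y \notin U -> bx \in U -> by_ \in U -> x + bx \notin E -> y + by_ \notin E ->
  {in U, forall v, v != bx -> x + v \in E} ->
  {in U, forall v, v != by_ -> y + v \in E} -> False.
Proof.
move=> U8 xU yU xyU bxU byU xbE ybE xE yE; have UD := closedD cU.
have cand t t' : t \in U -> t' \in U -> t != t' ->
    (x + y + t \in E) || (x + y + t' \in E).
  move=> tU t'U tt'; have ttU : t + t' \in U by apply: UD.
  (* The four forbidden values are those for which one of the points [x + w], [y + w + t],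
     [y + w + t'], [x + w + t + t'] of the 4-circuit is a missing one. *)
  have [w wU] : exists2 w, w \in U &
      w \notin [:: bx; bx + (t + t'); by_ + t; by_ + t'].
    by apply: avoid; apply: leq_trans U8.
  rewrite !inE !negb_or => /and4P[w1 w2 w3 w4].
  rewrite (_ : x + y + t = x + w + (y + (w + t))); last by char2.
  rewrite (_ : x + y + t' = x + w + (y + (w + t'))); last by char2.
  have xyw s : s \in U -> x + w != y + s.
    move=> sU; apply: contraNneq xyU => xwys.
    rewrite (_ : x + y = x + w + (y + s) + (s + w)); last by char2.
    by rewrite xwys addv2 add0r UD.
  apply: four_circuit.
  - exact: xE.
  - apply: yE; rewrite ?UD //.
    by apply: (addv_neq (z := w + (by_ + t))); [char2|rewrite addv_eq0].
  - apply: yE; rewrite ?UD //.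
    by apply: (addv_neq (z := w + (by_ + t'))); [char2|rewrite addv_eq0].
  - rewrite (_ : _ + _ = x + (w + (t + t'))); last by char2.
    apply: xE; rewrite ?UD //.
    by apply: (addv_neq (z := w + (bx + (t + t')))); [char2|rewrite addv_eq0].
  - by apply: xyw; apply: UD.
  - by apply: xyw; apply: UD.
  - by rewrite (inj_eq (addrI y)) (inj_eq (addrI w)).
have [u uU] : exists2 u, u \in U & u \notin [:: 0].
  by apply: avoid; apply: leq_trans U8.
rewrite inE => u0.
have [u' u'U] : exists2 v, v \in U & v \notin [:: 0; u].
  by apply: avoid; apply: leq_trans U8.
rewrite !inE negb_or => /andP[u'0 u'u].
have [t [tU t0 tE]] : exists t, [/\ t \in U, t != 0 & x + bx + (y + by_) + t \in E].
  have buU : bx + by_ + u \in U by rewrite !UD.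
  have bu'U : bx + by_ + u' \in U by rewrite !UD.
  have /orP[] : (x + y + (bx + by_ + u) \in E) || (x + y + (bx + by_ + u') \in E).
  - by apply: cand => //; rewrite (inj_eq (addrI _)) eq_sym.
  - by exists u; split=> //; rewrite (_ : _ + u = x + y + (bx + by_ + u)) //; char2.
  - by exists u'; split=> //; rewrite (_ : _ + u' = x + y + (bx + by_ + u')) //; char2.
have bt b : b + t != b by apply: (addv_neq (z := t)); first by char2.
have nU z b : z \notin U -> b \in U -> z + b != 0.
  by move=> zU bU; rewrite addv_eq0; apply: contraNneq zU => ->.
have nt z b : z \notin U -> b \in U -> t != z + (b + t).
  move=> zU bU; by apply: (addv_neq (z := z + b)); [char2|apply: nU].
have /orP[] : (t + (x + (bx + t)) \in E) || (t + (y + (by_ + t)) \in E).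
- apply: four_circuit.
  + exact: UE.
  + by apply: xE; rewrite ?UD ?bt.
  + by apply: yE; rewrite ?UD ?bt.
  + by apply: mem_eq tE _; char2.
  + exact: nt.
  + exact: nt.
  + by apply: (addv_neq (z := x + y + (bx + by_))); [char2|apply: nU => //; apply: UD].
- by rewrite (_ : _ + _ = x + bx) ?(negPf xbE) //; char2.
- by rewrite (_ : _ + _ = y + by_) ?(negPf ybE) //; char2.
Qed.

End Projective.

(** The induction on codimension makes [U] maximal, so every other coset misses a point of [E]. A
    triangle leaving [U] gives a coset with two points, hence with a single missing one; a triangle
    leaving the enlarged space [V] would give a second such coset, against [two_missing]. *)
Lemma projective_structure U : projective U -> (7 < #|U|)%N ->
  (exists2 V : {set W}, add_closed V & E = V :\ 0) \/
  (exists (V : {set W}) p, [/\ add_closed V, p \in V, p != 0 & E = V :\: [set 0; p]]).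
Proof.
have [n] := ubnP (#|W| - #|U|); elim: n U => // n IH U ltn pU U8.
have [cU UE] := pU; have UD := closedD cU.
have [/existsP[x /andP[xU /forall_inP xE]]|/existsPn maxU] := boolP [exists x,
  (x \notin U) && [forall w in extend U x, (w != 0) ==> (w \in E)]].
  have Ux : U \proper extend U x.
    apply/properP; split; first by apply/subsetP => u uU; rewrite inE uU.
    by exists x; rewrite // inE addv2 (proj1 cU) orbT.
  apply: (IH (extend U x)).
  - rewrite ltnS in ltn; apply: leq_trans ltn.
    apply: ltn_sub2l (proper_card Ux).
    exact: leq_trans (proper_card Ux) (max_card _).
  - split; first exact: extend_closed.
    by move=> w /xE/implyP.
  - exact: ltn_trans (proper_card Ux).
have {}maxU x : x \notin U -> exists2 b, b \in U & x + b \notin E.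
  move=> xU; have := maxU x; rewrite xU /= => /forall_inPn[w].
  rewrite inE negb_imply => wUx /andP[w0 wE]; exists (w + x).
    by case/orP: wUx => // wU; rewrite UE in wE.
  by rewrite (_ : _ + _ = w) //; char2.
have only x b u : x \in E -> x \notin U -> u \in U -> u != 0 -> x + u \in E ->
    b \in U -> x + b \notin E -> {in U, forall v, v != b -> x + v \in E}.
  move=> xE xU uU u0 xuE bU xb v vU; apply: contraR => xv; apply/eqP.
  exact: (attached_missing pU xE xU uU u0 xuE).
have [u uU] : exists2 u, u \in U & u \notin [:: 0].
  by apply: avoid; apply: leq_trans U8.
rewrite inE => u0; have uE := UE u uU u0.
have [/subsetP EU|/subsetPn[z zE zU]] := boolP (E \subset U).
  left; exists U => //; apply/setP => w; rewrite !inE.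
  by apply/idP/andP => [wE|[w0 wU]]; [rewrite neq0E ?EU|apply: UE].
have [a [x [aE xE aU xU axE]]] := crossing_triangle uE zE uU zU.
rewrite addrC in axE; have a0 := neq0E aE.
have [b bU xb] := maxU x xU.
have xall := only x b a xE xU aU a0 axE bU xb.
pose V := extend U x; have cV : add_closed V := extend_closed x cU.
have UV w : w \in U -> w \in V by rewrite inE => ->.
have xV w : w \in U -> x + w \in V.
  by move=> wU; rewrite inE (_ : x + w + x = w) ?wU ?orbT //; char2.
have p0 : x + b != 0 by rewrite addv_eq0; apply: contraNneq xU => ->.
have VE w : w \in V -> w != 0 -> w != x + b -> w \in E.
  rewrite inE => /orP[wU w0 _|wxU _ wxb]; first exact: UE.
  rewrite (_ : w = x + (w + x)); last by char2.
  apply: xall => //; rewrite -(inj_eq (addIr x)) (_ : w + x + x = w).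
    by rewrite addrC.
  by char2.
have [/subsetP EV|/subsetPn[z' z'E z'V]] := boolP (E \subset V).
  right; exists V, (x + b); split=> //; first exact: xV.
  apply/setP => w; rewrite !inE negb_or; apply/idP/andP => [wE|[/andP[w0 wp] wV]].
    split; last by have := EV w wE; rewrite inE.
    by rewrite neq0E //=; apply: contraNneq xb => <-.
  by apply: VE; rewrite // inE.
have [a' [y [a'E yE a'V yV ayE]]] := crossing_triangle uE z'E (UV u uU) z'V.
have [y' [y'E y'V [u' [u'U u'0 y'u']]]] : exists y', [/\ y' \in E, y' \notin V &
    exists u, [/\ u \in U, u != 0 & y' + u \in E]].
  have [a'U|a'U] := boolP (a' \in U).
    exists y; split=> //; exists a'; split=> //; first exact: neq0E.
    by rewrite addrC.
  (* With this choice of [v], [a' + v] is neither 0 nor the missing point [x + b]. The 4-circuit on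
     [y], [v], [a' + v] with sum [a' + y] then gives a second point in the coset of [y] or of
     [a' + y]. *)
  have [v vU] : exists2 v, v \in U & v \notin [:: 0; a' + (x + b)].
    by apply: avoid; apply: leq_trans U8.
  rewrite !inE negb_or => /andP[v0 va].
  have avE : a' + v \in E.
    apply: VE.
    - by apply: (closedD cV) => //; apply: UV.
    - by rewrite addv_eq0; apply: contraNneq a'U => ->.
    - by apply: (addv_neq (z := v + (a' + (x + b)))); [char2|rewrite addv_eq0].
  have nV t : t \in V -> y != t by move=> tV; apply: contraNneq yV => ->.
  have /orP[yv|yav] : (y + v \in E) || (y + (a' + v) \in E).
    apply: four_circuit => //.
    - exact: UE.
    - by rewrite (_ : _ + _ = a' + y) //; char2.
    - by apply/nV/UV.
    - by apply/nV/(closedD cV) => //; apply: UV.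
    - by apply: (addv_neq (z := a')); [char2|apply: neq0E].
  - by exists y; split=> //; exists v.
  - exists (a' + y); split=> //; first by rewrite closed_addl.
    by exists v; split=> //; rewrite (_ : _ + _ = y + (a' + v)) //; char2.
have y'U : y' \notin U by apply: contra y'V; apply: UV.
have [b' b'U y'b'] := maxU y' y'U.
have y'all := only y' b' u' y'E y'U u'U u'0 y'u' b'U y'b'.
case: (two_missing pU U8 xU y'U _ bU b'U xb y'b' xall y'all).
by apply: contra y'V => xyU; rewrite inE addrC xyU orbT.
Qed.

(** Together with 0, the seven points would form a projective subspace with eight elements. *)
Lemma no_fano : (forall U, projective U -> (#|U| <= 7)%N) ->
  forall a b c, a \in E -> b \in E -> c \in E -> a + b \in E -> a + c \in E ->
  b + c \in E -> a + b + c \in E -> False.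
Proof.
move=> noU a b c aE bE cE' abE acE bcE abcE.
have pairwise : uniq [:: 0; a; b; c; a + b; a + c; b + c; a + b + c].
  have nE x y z : z \in E -> x + y = z -> x == y = false.
    by move=> zE xyz; apply/negbTE/(addv_neq xyz)/neq0E.
  rewrite /= !inE !negb_or !andbT.
  by rewrite ?(nE 0 a a) ?(nE 0 b b) ?(nE 0 c c) ?(nE 0 (a + b) (a + b))
    ?(nE 0 (a + c) (a + c)) ?(nE 0 (b + c) (b + c))
    ?(nE 0 (a + b + c) (a + b + c)) ?(nE a b (a + b)) ?(nE a c (a + c))
    ?(nE a (a + b) b) ?(nE a (a + c) c) ?(nE a (b + c) (a + b + c))
    ?(nE a (a + b + c) (b + c)) ?(nE b c (b + c)) ?(nE b (a + b) a)
    ?(nE b (a + c) (a + b + c)) ?(nE b (b + c) c) ?(nE b (a + b + c) (a + c))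
    ?(nE c (a + b) (a + b + c)) ?(nE c (a + c) a) ?(nE c (b + c) b)
    ?(nE c (a + b + c) (a + b)) ?(nE (a + b) (a + c) (b + c))
    ?(nE (a + b) (b + c) (a + c)) ?(nE (a + b) (a + b + c) c)
    ?(nE (a + c) (b + c) (a + b)) ?(nE (a + c) (a + b + c) b)
    ?(nE (b + c) (a + b + c) a) //; char2.
pose U := [set x in [:: 0; a; b; c; a + b; a + c; b + c; a + b + c]].
have : (#|U| <= 7)%N; last first.
  by rewrite cardsE (card_uniqP pairwise).
apply: noU; split=> [|u]; last first.
  move=> + u0; rewrite in_set !inE (negPf u0) /=.
  by do 6?[case/predU1P=> [->//|]]; move/eqP->.
pose f (p q r : bool) :=
  (if p then a else 0) + (if q then b else 0) + (if r then c else 0).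
have Uf u : u \in U -> exists p q r, u = f p q r.
  rewrite in_set !inE; do 7?[case/predU1P=> [->|]]; last move/eqP->.
  - by exists false, false, false; rewrite /f; char2.
  - by exists true, false, false; rewrite /f; char2.
  - by exists false, true, false; rewrite /f; char2.
  - by exists false, false, true; rewrite /f; char2.
  - by exists true, true, false; rewrite /f; char2.
  - by exists true, false, true; rewrite /f; char2.
  - by exists false, true, true; rewrite /f; char2.
  - by exists true, true, true; rewrite /f; char2.
have fU p q r : f p q r \in U.
  by rewrite in_set !inE /f; case: p; case: q; case: r; rewrite ?addr0 ?add0r eqxx ?orbT.
split=> [|u v /Uf[p [q [r ->]]] /Uf[p' [q' [r' ->]]]]; first by rewrite in_set inE eqxx.
rewrite (_ : _ + _ = f (p (+) p') (q (+) q') (r (+) r')) ?fU // /f.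
by case: p; case: q; case: r; case: p'; case: q'; case: r'; rewrite /=; char2.
Qed.

(** * Sets without a Fano plane: stars of complete graphs *)

Section Star.

Hypothesis noF : forall a b c, a \in E -> b \in E -> c \in E -> a + b \in E ->
  a + c \in E -> b + c \in E -> a + b + c \in E -> False.

(** The model is the set of edges at one vertex of a complete graph: the sum of two of them is the
    edge joining their other ends. *)
Definition star D : Prop :=
  [/\ vfree D, D \subset E & {in D &, forall x y, x != y -> x + y \in E}].

(** Three elements would give a Fano plane. For a larger [A], replace [a] and [b] by [a + b]: a
    chord at [a + b], [c], [d] is the sum of a smaller subset that still has at least three
    elements, against the induction. *)
Lemma star_sum D A : star D -> A \subset D -> sum A \in E -> (#|A| <= 2)%N.
Proof.
move=> [fD DE DD] AD; have [n] := ubnP #|A|; elim: n A AD => // n IH A AD ltn sA.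
rewrite leqNgt; apply/negP => A3.
have [a [b [c [aA bA cA u3]]]] := size3 A3.
move: (u3); rewrite /= !inE negb_or => /and3P[/andP[ab ac] bc _].
have inD x : x \in A -> x \in D by apply: (subsetP AD).
have inE' x : x \in A -> x \in E by move=> /inD; apply: (subsetP DE).
have inEE x y : x \in A -> y \in A -> x != y -> x + y \in E.
  by move=> /inD xD /inD yD; apply: DD.
have A3s : [set a; b; c] \subset A by rewrite !subUset !sub1set aA bA cA.
have [AE|[d]] := set_0Vmem (A :\: [set a; b; c]).
  have A3E : A = [set a; b; c].
    by apply/eqP; rewrite eqEsubset A3s andbT -setD_eq0 AE.
  move: sA; rewrite A3E sum_set3 // => abcE.
  by apply: (noF (inE' a aA) (inE' b bA) (inE' c cA)) => //; apply: inEE.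
rewrite !inE !negb_or => /andP[/andP[/andP[da db] dc] dA].
pose B := A :\: [set a; b].
have Babc : A = a |: (b |: B).
  by rewrite setUA /B -{1}(setID A [set a; b]) (setIidPr _) // subUset !sub1set aA bA.
have aB : a \notin b |: B by rewrite !inE negb_or ab eqxx.
have bB : b \notin B by rewrite !inE eqxx orbT.
have abA : a + b \notin A.
  apply/negP => abA; have /setP/(_ a) : [set a; b] = [set a + b].
    apply: (vfree_inj fD); rewrite ?subUset ?sub1set ?inD //.
    by rewrite vsumU1 ?inE // !vsum1.
  rewrite !inE eqxx /= => /esym/eqP aab; have := neq0E (inE' b bA).
  suff -> : b = 0 by rewrite eqxx.
  by rewrite (_ : b = a + (a + b)); [rewrite -aab addv2|char2].
have abB : a + b \notin B by rewrite inE (negPf abA) andbF.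
pose L := (a + b) |: B.
have sL : sum L = sum A.
  by rewrite [in RHS]Babc !vsumU1 // addrA.
have fL : vfree L.
  move=> C CL C0; have [abC|abC] := boolP (a + b \in C); last first.
    apply: fD C0; apply/subsetP => t tC; have := subsetP CL t tC.
    case/setU1P=> [tE|/setDP[/inD]//]; by rewrite -tE tC in abC.
  have CB : C :\ (a + b) \subset B by rewrite subDset.
  have /setP/(_ a) : a |: (b |: C :\ (a + b)) = set0.
    apply: fD.
      rewrite !subUset !sub1set !inD // (subset_trans CB) //.
      exact: subset_trans (subsetDl _ _) AD.
    rewrite !vsumU1 ?addrA.
    - by transitivity (sum C); rewrite // (vsumD1 (@id W) abC).
    - by apply: contra bB; apply: (subsetP CB).
    - by apply: contra aB; rewrite !in_setU1 => /orP[->//|/(subsetP CB)->]; rewrite orbT.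
  by rewrite !inE eqxx.
have LE : L \subset E.
  rewrite subUset sub1set inEE //=; apply/subsetP => t /setDP[tA _]; exact: inE'.
have cL : c \in L by rewrite !inE negb_or !(eq_sym c) ac bc cA orbT.
have dL : d \in L by rewrite !inE negb_or da db dA orbT.
have abL : a + b \in L by rewrite !inE eqxx.
have nA x : x \in A -> a + b != x by move=> xA; apply: contraNneq abA => ->.
have u3' : uniq [:: a + b; c; d].
  by rewrite /= !inE negb_or !nA // eq_sym dc.
rewrite -sL in sA; have [J JL ch] := chE LE fL sA abL cL dL u3'.
have JB : J \subset B :\: [set c; d].
  apply/subsetP => t /(subsetP JL); rewrite !inE !negb_or.
  by case/andP=> /andP[/andP[/negPf-> -> ->]] /=.
have step e f : e \in A -> f \in A -> e \in [set c; d] -> f \in [set c; d] ->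
    e != f -> a + b + e + sum J \in E -> False.
  move=> eA fA ecd fcd ef eJ.
  have [eab fab] : e \notin [set a; b] /\ f \notin [set a; b].
    by split; [case/set2P: ecd|case/set2P: fcd] => ->;
      rewrite !inE negb_or ?da ?db ?(eq_sym c) ?ac ?bc.
  have JA : J \subset A.
    by apply: subset_trans JB _; apply: subset_trans (subsetDl _ _) (subsetDl _ _).
  have eJn : e \notin J.
    by apply/negP => /(subsetP JB)/setDP[_]; rewrite ecd.
  have fJn : f \notin J.
    by apply/negP => /(subsetP JB)/setDP[_]; rewrite fcd.
  have abJ : {in [set a; b], forall t, t \notin J}.
    by move=> t tab; apply/negP => /(subsetP JB)/setDP[/setDP[_]]; rewrite tab.
  pose A' := a |: (b |: (e |: J)).
  have be : b \notin e |: J.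
    rewrite !inE negb_or abJ ?inE ?eqxx ?orbT // andbT.
    by apply: contraNneq eab => <-; rewrite !inE eqxx orbT.
  have ae : a \notin b |: (e |: J).
    rewrite !inE !negb_or ab abJ ?inE ?eqxx //= andbT.
    by apply: contraNneq eab => <-; rewrite !inE eqxx.
  have A'A : A' \subset A by rewrite !subUset !sub1set aA bA eA.
  have fA' : f \notin A'.
    move: fab; rewrite !inE !negb_or => /andP[-> ->] /=.
    by rewrite eq_sym ef.
  have ltA : (#|A'| < #|A|)%N.
    by apply/proper_card/properP; split=> //; exists f.
  have sA' : sum A' = a + b + e + sum J by rewrite !vsumU1 // !addrA.
  have := IH A' (subset_trans A'A AD) (leq_trans ltA ltn).
  by rewrite sA' => /(_ eJ); rewrite !cardsU1 ae be eJn.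
case/orP: ch; first by apply: (step c d); rewrite ?inE ?eqxx ?orbT // eq_sym.
by apply: (step d c); rewrite ?inE ?eqxx ?orbT.
Qed.

Definition star_points D :=
  [set w | (w \in D) ||
     [exists x in D, exists y in D, (x != y) && (w == x + y)]].

Lemma star_pointsP D w : reflect
  (w \in D \/ exists x y, [/\ x \in D, y \in D, x != y & w = x + y])
  (w \in star_points D).
Proof.
rewrite inE; apply: (iffP orP) => -[wD|h]; [by left| |by left|].
  right; case/exists_inP: h => x xD /exists_inP[y yD /andP[xy /eqP->]].
  by exists x, y.
right; case: h => x [y [xD yD xy ->]]; apply/exists_inP; exists x => //.
by apply/exists_inP; exists y; rewrite // xy eqxx.
Qed.

Lemma star_span D w : star D -> w \in E -> w \in F2span (@id W) D ->
  w \in star_points D.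
Proof.
move=> sD wE /F2spanP[A AD wA]; rewrite wA in wE *.
have A2 := star_sum sD AD wE; apply/star_pointsP.
have [A0|[x xA]] := set_0Vmem A.
  by rewrite A0 vsum0 (negPf E0) in wE.
have [A1|[y]] := set_0Vmem (A :\ x).
  by left; rewrite (vsumD1 _ xA) A1 vsum0 addr0 (subsetP AD).
case/setD1P=> yx yA; right; exists x, y; split; rewrite ?(subsetP AD) 1?eq_sym //.
have -> : A = [set x; y].
  apply/esym/eqP; rewrite eqEcard subUset !sub1set xA yA cards2.
  by rewrite eq_sym yx.
by rewrite vsumU1 ?vsum1 // inE eq_sym.
Qed.

Lemma star_add D x : star D -> x \in E -> x \notin F2span (@id W) D ->
  {in D, forall d, x + d \in E} -> star (x |: D).
Proof.
move=> [fD DE DD] xE xD xd; split.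
- move=> A AxD A0; have [xA|xA] := boolP (x \in A).
    case/negP: xD; apply/F2spanP; exists (A :\ x); first by rewrite subDset.
    apply/eqP; rewrite -addv_eq0; apply/eqP.
    by transitivity (sum A); rewrite // (vsumD1 (@id W) xA).
  apply: fD A0; apply/subsetP => t tA; have := subsetP AxD t tA.
  by case/setU1P=> // tx; rewrite -tx tA in xA.
- by rewrite subUset sub1set xE.
move=> u v /setU1P[->|uD] /setU1P[->|vD]; rewrite ?eqxx // => uv.
- exact: xd.
- by rewrite addrC xd.
- exact: DD.
Qed.

(** In the graph, [x] and [x + d] join a new vertex to the two ends of [d], and the one that reaches
    the centre extends the star. If [x] failed at [v] and [x + d] at [u], two 4-circuits would give
    a contradiction. *)
Lemma star_extend D d x : star D -> d \in D -> x \in E ->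
  x \notin F2span (@id W) D -> x + d \in E ->
  exists2 y, y \notin D & star (y |: D).
Proof.
move=> sD dD xE xD xdE; have [fD DE DD] := sD.
have DE' : {in D, forall u, u \in E} by apply/subsetP.
have cD := F2span_closed (@id W) D.
have Dspan u : u \in D -> u \in F2span (@id W) D.
  by move=> uD; apply: (mem_F2span (@id W)).
have notD y : y \notin F2span (@id W) D -> y \notin D.
  by apply: contra => /Dspan.
have one u y : u \in D -> u != d -> y \in E -> y \notin F2span (@id W) D ->
    y + d \in E -> (y + u \in E) || (y + d + u \in E).
  move=> uD ud yE yD ydE.
  have ny t : t \in F2span (@id W) D -> y != t by move=> tD; apply: contraNneq yD => ->.
  rewrite -addrA; apply: four_circuit => //; try exact: DE'.
  - by rewrite DD // eq_sym.
  - by apply: mem_eq ydE _; char2.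
  - by apply/ny/Dspan.
  - by apply/ny/(closedD cD); apply: Dspan.
  - by apply: (addv_neq (z := d)); [char2|apply: neq0E; apply: DE'].
have xdD : x + d \notin F2span (@id W) D by rewrite (closed_addr _ cD) // Dspan.
have [/forall_inP xall|/forall_inPn[v vD xv]] := boolP [forall u in D, x + u \in E].
  by exists x; [apply: notD|apply: star_add].
have [/forall_inP xall|/forall_inPn[u uD xu]] :=
    boolP [forall u in D, x + d + u \in E].
  by exists (x + d); [apply: notD|apply: star_add].
exfalso.
have vd : v != d by apply: contraNneq xv => ->.
have ud : u != d by apply: contraNneq xu => ->; apply: mem_eq xE _; char2.
have xdv : x + d + v \in E by have := one v x vD vd xE xD xdE; rewrite (negPf xv).
have xu' : x + u \in E by have := one u x uD ud xE xD xdE; rewrite (negPf xu) orbF.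
have uv : u != v by apply: contraNneq xv => <-.
have duv : d + u + v \notin E.
  apply/negP; apply: (noF (DE' d dD) (DE' u uD) (DE' v vD));
    by apply: DD => //; rewrite eq_sym.
have nx y t : y \notin F2span (@id W) D -> t \in F2span (@id W) D -> t != y.
  by move=> yD tD; apply: contraNneq yD => <-.
have uvn : d + u + v != 0.
  apply/eqP => duv0; have u3 : uniq [:: d; u; v].
    by rewrite /= !inE negb_or !(eq_sym d) ud vd uv.
  have /setP/(_ d) : [set d; u; v] = set0.
    apply: fD; first by rewrite !subUset !sub1set dD uD vD.
    by rewrite sum_set3.
  by rewrite !inE eqxx.
have xuD : x + u \notin F2span (@id W) D by rewrite (closed_addr _ cD (Dspan u uD)).
(* The 4-circuit on [v], [d + u], [x + u] has sum [x + d + v], and its chord [d + u + v] is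
   excluded. *)
have xuv : x + u + v \in E.
  have /orP[] : (v + (d + u) \in E) || (v + (x + u) \in E).
  - apply: four_circuit => //; first exact: DE'.
    + by rewrite DD // eq_sym.
    + by apply: mem_eq xdv _; char2.
    + by apply: (addv_neq (z := d + u + v)); first by char2.
    + by apply: nx => //; apply: Dspan.
    + by apply: nx => //; apply: (closedD cD); apply: Dspan.
  - by rewrite (_ : v + _ = d + u + v) ?(negPf duv) //; char2.
  - by move=> h; apply: mem_eq h _; char2.
(* The 4-circuit on [u], [d + v], [x + d] has sum [x + u + v], and both chords are excluded. *)
have /orP[] : (u + (d + v) \in E) || (u + (x + d) \in E).
- apply: four_circuit => //; first exact: DE'.
  + by rewrite DD // eq_sym.
  + by apply: mem_eq xuv _; char2.
  + by apply: (addv_neq (z := d + u + v)); first by char2.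
  + by apply: nx => //; apply: Dspan.
  + by apply: nx => //; apply: (closedD cD); apply: Dspan.
- by rewrite (_ : u + _ = d + u + v) ?(negPf duv) //; char2.
- by rewrite (_ : u + _ = x + d + u) ?(negPf xu) //; char2.
Qed.

(** The induction enlarges [D] as long as some point is not a star point. Such a point is outside
    the span of [D] by [star_span], so for nonempty [D] a triangle leaves the span, and it can be
    moved to one through an element of [D]. *)
Lemma star_structure D : star D -> exists2 D' : {set W}, vfree D' & E = star_points D'.
Proof.
have [n] := ubnP (#|W| - #|D|); elim: n D => // n IH D ltn sD.
have [fD DE DD] := sD; have cD := F2span_closed (@id W) D.
have grow y : y \notin D -> star (y |: D) ->
    exists2 D' : {set W}, vfree D' & E = star_points D'.
  move=> yD; apply: IH; rewrite ltnS in ltn; apply: leq_trans ltn.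
  have yDc : (#|y |: D| = #|D|.+1)%N by rewrite cardsU1 yD.
  rewrite yDc; apply: ltn_sub2l => //; rewrite -yDc; exact: max_card.
have [/subsetP ED|/subsetPn[z zE zD]] := boolP (E \subset star_points D).
  exists D => //; apply/setP => w; apply/idP/star_pointsP => [/ED/star_pointsP//|].
  by case=> [/(subsetP DE)//|[x [y [xD yD xy ->]]]]; apply: DD.
have zS : z \notin F2span (@id W) D by apply: contra zD; apply: star_span.
have [D0|[d dD]] := set_0Vmem D.
  apply: (grow z); first by rewrite D0 inE.
  by apply: star_add => // u; rewrite D0 inE.
have dS : d \in [set w in F2span (@id W) D].
  by rewrite in_set; apply: (mem_F2span (@id W)).
have zS' : z \notin [set w in F2span (@id W) D] by rewrite in_set.
have [v [x [vE xE]]] := crossing_triangle (subsetP DE d dD) zE dS zS'.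
rewrite !in_set => vS xS vxE.
have [d' d'D xd'] : exists2 d', d' \in D & x + d' \in E.
  case/star_pointsP: (star_span sD vE vS) => [vD|[p [q [pD qD pq vpq]]]].
    by exists v; rewrite // addrC.
  have nx t : t \in D -> x != t.
    by move=> tD; apply: contraNneq xS => ->; apply: (mem_F2span (@id W)).
  have /orP[xp|xq] : (x + p \in E) || (x + q \in E).
  - apply: four_circuit => //; try exact: (subsetP DE).
    + by apply: mem_eq vxE _; rewrite vpq; char2.
    + exact: nx.
    + exact: nx.
  - by exists p.
  - by exists q.
have [y yD sy] := star_extend sD d'D xE xS xd'.
exact: (grow y).
Qed.

End Star.

Theorem chordal_structure :
  [\/ exists2 V : {set W}, add_closed V & E = V :\ 0,
      exists (V : {set W}) p,
        [/\ add_closed V, p \in V, p != 0 & E = V :\: [set 0; p]] |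
      exists2 D : {set W}, vfree D & E = star_points D].
Proof.
have [/existsP[U /and4P[U0 /forall_inP UD /forall_inP UE U8]]|/existsPn noU] :=
    boolP [exists U : {set W}, [&& 0 \in U,
      [forall x in U, [forall y in U, x + y \in U]],
      [forall x in U, (x != 0) ==> (x \in E)] & (7 < #|U|)%N]].
  have pU : projective U.
    split; last by move=> u /UE/implyP.
    by split=> // x y /UD/forall_inP; apply.
  by case: (projective_structure pU U8) => h; [apply: Or31|apply: Or32].
apply: Or33; apply: (@star_structure _ set0).
- apply: no_fano => U [[U0 UD] UE]; rewrite leqNgt; apply/negP => U8.
  case/and4P: (noU U); split=> //; last by apply/forall_inP => u /UE uE; apply/implyP.
  by apply/forall_inP => x xU; apply/forall_inP => y; apply: UD.
- split; [|exact: sub0set|by move=> x y; rewrite inE].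
  by move=> A; rewrite subset0 => /eqP.
Qed.
End Structure.

(** * From the matroid to its set of vectors *)

Lemma vsum_imset (W : finLmodType 'F_2) (T : finType) (phi : T -> W)
    (A : {set T}) : {in A &, injective phi} ->
  vsum (@id W) (phi @: A) = vsum phi A.
Proof. by move=> injphi; rewrite /vsum big_imset. Qed.

Section FromMatroid.

Variables (W : finLmodType 'F_2) (T : finType) (M : matroid T) (phi : T -> W).
Hypotheses (rM : represents M phi (F2span phi set0)) (simpM : simple_matroid M).

Let cK : add_closed (F2span phi set0) := F2span_closed phi set0.

Lemma simple_neq0 x : x \in ground M -> phi x != 0.
Proof.
move=> xM; have [nl _] := simpM x x.
by move: nl; rewrite (loopE rM xM) F2span0.
Qed.

Lemma simple_inj : {in ground M &, injective phi}.
Proof.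
move=> x y xM yM xy; apply/eqP; apply: contraT => nxy.
have [_ /negP[]] := simpM x y; apply/(parallelP rM).
by split; rewrite ?F2span0 ?inE ?simple_neq0 // xy addv2.
Qed.

Let E := phi @: ground M.

Lemma image_neq0 : 0 \notin E.
Proof.
by apply/imsetP => -[x xM x0]; have := simple_neq0 xM; rewrite -x0 eqxx.
Qed.

Lemma image_connected : connected_matroid M -> vconnected E.
Proof.
move=> connM _ _ /imsetP[x xM ->] /imsetP[y yM ->] xy.
have nxy : x != y by apply: contraNneq xy => ->.
have [C cC /andP[xC yC]] := connM x y xM yM nxy.
have [CM CI Cm] := circuit_dep cC.
have injC (A : {set T}) : A \subset C -> {in A &, injective phi}.
  move=> CA u v uA vA; apply: simple_inj; apply: (subsetP CM);
  exact: (subsetP CA).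
exists (phi @: C); split; rewrite ?imset_f ?imsetS //.
  rewrite vsum_imset; last exact: injC.
  by have := circuit_vsum rM cC; rewrite F2span0 => /eqP.
move=> A CA A0; pose B := [set u in C | phi u \in A].
have BC : B \subset C by apply/subsetP => u; rewrite inE => /andP[].
have AE : A = phi @: B.
  apply/setP => w; apply/idP/imsetP => [wA|[u]]; last first.
    by rewrite inE => /andP[_ uA] ->.
  have /imsetP[u uC wE] := subsetP CA w wA.
  by exists u; rewrite // inE uC -wE.
have [BE|nBC] := eqVneq B C; first by right; rewrite AE BE.
left; have /Cm BI : B \proper C by rewrite properEneq nBC.
have B0 : vsum phi B = 0.
  by rewrite -(vsum_imset (injC B BC)) -AE A0.
have [_ /(_ B (subxx _))] := (rM B).1 BI.
by rewrite B0 AE => -> //; [rewrite imset0|case: cK].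
Qed.

(** The elements over [L] other than [a, b, c] are contracted; independence of [L] keeps the
    4-circuit nondegenerate, and a chord modulo their span is a chord up to a sum over some [J]. *)
Lemma image_chordal : has_chords M phi -> chordal E.
Proof.
move=> chM L a b c LE fL sL aL bL cL u3.
have inE' w : w \in L -> exists2 x, x \in ground M & w = phi x.
  by move=> /(subsetP LE)/imsetP.
have [a0 aM aE] := inE' a aL; have [b0 bM bE] := inE' b bL.
have [c0 cM cE] := inE' c cL; have /imsetP[d0 dM dE] := sL.
pose R := L :\: [set a; b; c]; pose X := [set x in ground M | phi x \in R].
have XM : X \subset ground M by apply/subsetP => x; rewrite inE => /andP[].
have spanX w : w \in F2span phi X ->
    exists2 J : {set W}, J \subset R & w = vsum (@id W) J.
  case/F2spanP=> A AX ->; exists (phi @: A).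
    by apply/subsetP => _ /imsetP[x /(subsetP AX) + ->]; rewrite inE => /andP[].
  rewrite vsum_imset // => x y /(subsetP AX)/(subsetP XM) xM.
  by move=> /(subsetP AX)/(subsetP XM); apply: simple_inj.
have RK : vsum (@id W) R \in F2span phi X.
  rewrite (_ : R = phi @: X).
    rewrite vsum_imset; first exact: vsum_F2span.
    by move=> x y /(subsetP XM) xM /(subsetP XM); apply: simple_inj.
  apply/setP => w; apply/idP/imsetP => [wR|[x]]; last first.
    by rewrite inE => /andP[_ xR] ->.
  have [x xM wE] := inE' w (subsetP (subsetDl _ _) w wR).
  by exists x; rewrite // inE xM -wE.
have cX := F2span_closed phi X.
have abcL : [set a; b; c] \subset L by rewrite !subUset !sub1set aL bL cL.
have dsum : phi d0 = a + b + c + vsum (@id W) R.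
  by rewrite -dE (vsumID _ L [set a; b; c]) (setIidPr abcL) sum_set3.
have out (A : {set W}) : A \subset [set a; b; c] -> A != set0 ->
    vsum (@id W) A \notin F2span phi X.
  move=> A3 A0; apply/negP => /spanX[J JR AJ].
  have JE : A = J.
    apply: (vfree_inj fL) AJ; first exact: subset_trans A3 abcL.
    exact: subset_trans JR (subsetDl _ _).
  case/set0Pn: A0 => w wA; have := subsetP JR w.
  by rewrite -JE wA in_setD (subsetP A3 w wA) => /(_ isT).
move: (u3); rewrite /= !inE negb_or => /and3P[/andP[ab ac] bc _].
have out1 w : w \in [set a; b; c] -> w \notin F2span phi X.
  move=> w3; rewrite -[w](vsum1 (@id W)) out ?sub1set //.
  by apply/set0Pn; exists w; rewrite inE.
have out2 v w : v != w -> v \in [set a; b; c] -> w \in [set a; b; c] ->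
    v + w \notin F2span phi X.
  move=> vw v3 w3; have := out [set v; w]; rewrite vsumU1 ?inE // vsum1.
  by apply; [rewrite subUset !sub1set v3|apply/set0Pn; exists v; rewrite !inE eqxx].
have out3 : a + b + c \notin F2span phi X.
  by rewrite -sum_set3 // out //; apply/set0Pn; exists a; rewrite !inE eqxx.
have [|||x xM] := chM X a0 b0 c0 d0 XM aM bM cM dM; rewrite -?aE -?bE -?cE.
- by apply: mem_eq RK _; rewrite dsum; char2.
- split; try by apply: out1; rewrite !inE eqxx ?orbT.
  by rewrite dsum (closed_addr _ cX RK).
- split; try by apply: out2; rewrite // !inE eqxx ?orbT.
  rewrite (_ : a + phi d0 = b + c + vsum (@id W) R); last by rewrite dsum; char2.
  by rewrite (closed_addr _ cX RK) out2 // !inE eqxx ?orbT.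
have xE : phi x \in E by apply: imset_f.
case/orP=> /spanX[J JR JE]; exists J => //; apply/orP; [left|right].
  by apply: mem_eq xE _; rewrite -JE; char2.
by apply: mem_eq xE _; rewrite -JE; char2.
Qed.

End FromMatroid.

(** * From the set of vectors back to the matroid *)

Lemma represents_eq (W : lmodType 'F_2) (T : finType) (M : matroid T)
    (phi : T -> W) (K K' : {pred W}) :
  K =i K' -> represents M phi K -> represents M phi K'.
Proof.
move=> KK rM I; split=> [/rM|] [IM iI].
  by split=> // A AI; rewrite -KK; apply: iI.
by apply/rM; split=> // A AI; rewrite KK; apply: iI.
Qed.

Lemma represents_comp (W W' : lmodType 'F_2) (T : finType) (M : matroid T)
    (phi : T -> W) (g : {linear W -> W'}) :
  injective g -> represents M phi (F2span phi set0) ->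
  represents M (g \o phi) (F2span (g \o phi) set0).
Proof.
move=> injg rM I.
have gK A : (vsum (g \o phi) A \in F2span (g \o phi) set0) =
            (vsum phi A \in F2span phi set0).
  rewrite !F2span0 !inE (_ : vsum _ _ = g (vsum phi A)) ?raddf_eq0 //.
  by rewrite /vsum raddf_sum.
split=> [/rM|] [IM iI]; first by split=> // A AI; rewrite gK; apply: iI.
by apply/rM; split=> // A AI; rewrite -gK; apply: iI.
Qed.

(** Coordinates in a basis identify a subspace with a full space of row vectors, the home of
    [binary_pg]. *)
Lemma closed_coordinates (m : nat) (V : {set 'cV['F_2]_m}) : add_closed V ->
  exists n (g : {linear 'rV['F_2]_n -> 'cV['F_2]_m}),
    injective g /\ forall w, w \in V <-> exists r, w = g r.
Proof.
move=> cV; pose U := <<enum V>>%VS.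
have VU w : (w \in V) = (w \in U).
  have := vspace_F2span (@id 'cV['F_2]_m) V w; rewrite map_id => ->.
  apply/idP/idP => [wV|]; first exact: (mem_F2span (@id _)).
  exact: sub_F2span.
pose g (r : 'rV['F_2]_(\dim U)) : 'cV['F_2]_m := \sum_i r 0 i *: (vbasis U)`_i.
have g_lin : linear g.
  move=> a r s; rewrite /g scaler_sumr -big_split /=; apply: eq_bigr => i _.
  by rewrite !mxE scalerDl scalerA.
pose gL : {linear 'rV['F_2]_(\dim U) -> 'cV['F_2]_m} :=
  HB.pack g (GRing.isLinear.Build _ _ _ _ g g_lin).
exists (\dim U), gL; split.
  apply: raddf_inj => r r0; apply/rowP => i; rewrite mxE.
  have /freeP := basis_free (vbasisP U); apply; exact: r0.
move=> w; rewrite VU; split=> [wU|[r ->]].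
  exists (\row_i coord (vbasis U) i w); rewrite /= /g {1}(coord_vbasis wU).
  by apply: eq_bigr => i _; rewrite mxE.
apply: memv_suml => i _; apply: memvZ; apply: vbasis_mem.
by apply: mem_nth; rewrite size_tuple.
Qed.

Section ToMatroid.

Variables (m : nat) (T : finType) (M : matroid T) (phi : T -> 'cV['F_2]_m).
Hypotheses (rM : represents M phi (F2span phi set0))
  (injM : {in ground M &, injective phi}).
Implicit Types V D : {set 'cV['F_2]_m}.

Let K := F2span phi set0.
Let cK : add_closed K := F2span_closed phi set0.
Let K0 x : (x \in K) = (x == 0) := F2span0 phi x.

Lemma isomorphic_image (U : finType) (N : matroid U) (psi : U -> 'cV['F_2]_m) :
  represents N psi (F2span psi set0) -> {in ground N &, injective psi} ->
  phi @: ground M = psi @: ground N -> isomorphic M N.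
Proof.
move=> rN injN MN.
have rN' : represents N psi K.
  by apply: represents_eq rN => w; rewrite !F2span0.
apply: (rep_isomorphic cK rM rN') => [x y xM yM|x y xN yN|x xM|y yN].
- by rewrite K0 addv_eq0 => /eqP; apply: injM.
- by rewrite K0 addv_eq0 => /eqP; apply: injN.
- have /imsetP[y yN xy] : phi x \in psi @: ground N by rewrite -MN imset_f.
  by exists y; rewrite // K0 xy addv2.
- have /imsetP[x xM xy] : psi y \in phi @: ground M by rewrite MN imset_f.
  by exists x; rewrite // K0 xy addv2.
Qed.

Lemma isomorphic_pg V : add_closed V -> phi @: ground M = V :\ 0 ->
  exists n, isomorphic M (binary_pg n).
Proof.
move=> cV ME; have [n [g [injg gV]]] := closed_coordinates cV.
exists n; apply: (isomorphic_image (psi := g \o id)).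
- apply: represents_comp => //; exact: rep_vector.
- by move=> r s _ _ /injg.
apply/setP => w; rewrite ME; apply/idP/imsetP => [|[r]].
  rewrite !inE => /andP[w0 /gV[r wr]]; exists r => //=.
  by rewrite inE; apply: contraNneq w0 => r0; rewrite wr r0 raddf0.
rewrite inE => r0 ->; rewrite !inE raddf_eq0 // r0 /=.
by apply/gV; exists r.
Qed.

Lemma isomorphic_pg_delete V p : add_closed V -> p \in V -> p != 0 ->
  phi @: ground M = V :\: [set 0; p] ->
  exists n (q : 'rV['F_2]_n), q \in ground (binary_pg n) /\
    isomorphic M (delete (binary_pg n) [set q]).
Proof.
move=> cV pV p0 ME; have [n [g [injg gV]]] := closed_coordinates cV.
have [q pq] := (gV p).1 pV.
have q0 : q != 0 by apply: contraNneq p0 => q0; rewrite pq q0 raddf0.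
exists n, q; split; first by rewrite inE.
apply: (isomorphic_image (psi := g \o id)).
- by apply/rep_restrict/represents_comp => //; apply: rep_vector.
- by move=> r s _ _ /injg.
apply/setP => w; rewrite ME; apply/idP/imsetP => [|[r]].
  rewrite !inE negb_or => /andP[/andP[w0 wp] /gV[r wr]]; exists r => //=.
  rewrite !inE; apply/andP; split.
    by apply: contraNneq w0 => r0; rewrite wr r0 raddf0.
  by apply: contraNneq wp => rq; rewrite wr pq rq.
rewrite !inE => /andP[r0 rq] ->; rewrite /= negb_or raddf_eq0 // r0 /=.
rewrite pq (inj_eq injg) rq /=; by apply/gV; exists r.
Qed.

Lemma isomorphic_complete D : vfree D -> phi @: ground M = star_points D ->
  exists n, isomorphic M (cycle_matroid (complete_graph n)).
Proof.
(* Vertex [ord0] receives the zero vector and the other vertices the elements of [D]; the edges at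
   [ord0] are then [D], and the remaining edges its pairwise sums. *)
move=> fD ME; pose s := 0 :: enum D.
have D0 : 0 \notin D.
  apply/negP => D0; have /setP/(_ 0) : [set 0] = set0 :> {set 'cV['F_2]_m}.
    by apply: fD; rewrite ?sub1set ?vsum1.
  by rewrite !inE eqxx.
have us : uniq s by rewrite /= mem_enum D0 enum_uniq.
have ss : size s = #|D|.+1 by rewrite /= -cardE.
pose d (i : 'I_#|D|.+1) := s`_i.
have injd : injective d.
  move=> i j /eqP; rewrite nth_uniq ?ss ?ltn_ord // => /eqP; exact: val_inj.
have dD i : i != ord0 -> d i \in D.
  case: i => -[|i] // id _; rewrite /d /= -mem_enum mem_nth //.
  by rewrite -cardE.
have exd w : w \in s -> exists i, w = d i.
  move=> ws; have lt : (index w s < #|D|.+1)%N by rewrite -ss index_mem.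
  by exists (Ordinal lt); rewrite /d /= nth_index.
exists #|D|.+1; apply: (isomorphic_cycle (d := d) cK rM) => [x y xM yM|B oB|x xM|i j].
- by rewrite K0 addv_eq0 => /eqP; apply: injM.
- rewrite K0 => /eqP B0.
  have dB : vsum (@id _) (d @: (B :\ ord0)) = 0.
    rewrite vsum_imset; last by move=> i j _ _ /injd.
    have [oB0|oB0] := boolP (ord0 \in B).
      by move: B0; rewrite (vsumD1 _ oB0) {1}/d /= add0r.
    rewrite -B0; congr vsum; apply/setP => i; rewrite !inE.
    by case: eqVneq => // ->; rewrite (negPf oB0).
  have : d @: (B :\ ord0) = set0.
    apply: fD dB; apply/subsetP => _ /imsetP[i /setD1P[i0 _] ->]; exact: dD.
  move/eqP; rewrite imset_eq0 setD_eq0 subset1 => /orP[/eqP BE|/eqP//].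
  by rewrite BE cards1 in oB.
- have : phi x \in star_points D by rewrite -ME imset_f.
  case/star_pointsP=> [xD|[v [w [vD wD vw xE]]]].
    have [i xi] : exists i, phi x = d i by apply: exd; rewrite inE mem_enum xD orbT.
    exists ord0, i; split; last by rewrite K0 xi [d ord0]/d /= add0r addv2.
    by apply: contraNneq D0 => i0; rewrite -[0]/(d ord0) i0 -xi.
  have [i vi] : exists i, v = d i by apply: exd; rewrite inE mem_enum vD orbT.
  have [j wj] : exists i, w = d i by apply: exd; rewrite inE mem_enum wD orbT.
  exists i, j; split; last by rewrite K0 xE vi wj addv2.
  by apply: contraNneq vw => ij; rewrite vi wj ij.
- rewrite /= /complete_adj => ij.
  suff : d i + d j \in phi @: ground M.
    by case/imsetP=> x xM xE; exists x; rewrite // K0 xE addv2.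
  rewrite ME; apply/star_pointsP.
  have d0 : d ord0 = 0 by [].
  have [i0|i0] := eqVneq i ord0.
    by left; rewrite i0 d0 add0r dD // -i0 eq_sym.
  have [j0|j0] := eqVneq j ord0; first by left; rewrite j0 d0 addr0 dD.
  by right; exists (d i), (d j); rewrite !dD // (inj_eq injd).
Qed.

End ToMatroid.

(** * The three families have the chord property *)

(** Here [p] is the missing point, or 0 for the full geometry. If [a + b] and [a + c] were both [p],
    then [b] and [c] would have the same vector and [a + d] would lie in [K]. *)
Lemma pg_has_chords (W : lmodType 'F_2) (T : finType) (M : matroid T)
    (phi : T -> W) (p : W) :
  (forall x y, x \in ground M -> y \in ground M -> phi x + phi y != 0 ->
    phi x + phi y != p -> exists2 z, z \in ground M & phi z = phi x + phi y) ->
  has_chords M phi.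
Proof.
move=> sumM X a b c d K XM aM bM cM dM sK [aK bK cK' dK] [abK acK adK].
have cK : add_closed K by apply: F2span_closed.
have neq0 w : w \notin K -> w != 0 by apply: contraNneq => ->; case: cK.
have [abp|abp] := eqVneq (phi a + phi b) p; last first.
  have [x xM xE] := sumM a b aM bM (neq0 _ abK) abp.
  by exists x; rewrite // xE addv2 (proj1 cK).
have [acp|acp] := eqVneq (phi a + phi c) p; last first.
  have [x xM xE] := sumM a c aM cM (neq0 _ acK) acp.
  by exists x; rewrite // xE addv2 (proj1 cK) orbT.
case/negP: adK; apply: mem_eq sK _.
have -> : phi c = phi b by apply: (addrI (phi a)); rewrite acp abp.
by char2.
Qed.

(* The edges in X join vertices of the same class modulo K, so that the       *)
(* number of ends in a given class, modulo 2, only depends on the class of a  *)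
(* sum of edges modulo K. Hence each end of a is equivalent to an end of b, c *)
(* or d, which yields a chord.                                                *)
Lemma complete_has_chords (T : finType) (M : matroid T) (n : nat)
    (phi : T -> {ffun 'I_n -> GRing.regular 'F_2}) :
  {in ground M, forall x, exists2 e, e \in edges (complete_graph n) &
    phi x = edge_vec e} ->
  {in edges (complete_graph n), forall e, exists2 x, x \in ground M &
    phi x = edge_vec e} ->
  has_chords M phi.
Proof.
move=> ME EM X a b c d K XM aM bM cM dM sK [aK bK cK' dK] [abK acK adK].
have cK : add_closed K by apply: F2span_closed.
pose dl (v : 'I_n) := edge_vec [set v].
have end_ x : x \in ground M -> exists u w, u != w /\ phi x = dl u + dl w.
  move=> /ME[e /edgesP[u [w [uw eE]]] xE]; exists u, w; split=> //.
  by rewrite /dl -edge_vec2 // -eE.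
have mkE u w : u != w -> exists2 x, x \in ground M & phi x = dl u + dl w.
  move=> uw; have [|x xM xE] := EM [set u; w]; first by rewrite edgeE.
  by exists x; rewrite // xE edge_vec2.
have key i j : phi a = dl i + dl j -> exists z k l,
    [/\ [\/ z = b, z = c | z = d], phi z = dl k + dl l & dl k + dl i \in K].
  move=> aij; pose C := [set v | dl v + dl i \in K].
  (* [chi] counts modulo 2 the ends in the class [C] of [i]. It vanishes on [K] and is 1 on [a], so
     it is nonzero on one of [b], [c], [d]. *)
  pose chi (w : {ffun 'I_n -> GRing.regular 'F_2}) : 'F_2 := \sum_(v in C) w v.
  have chiD u w : chi (u + w) = chi u + chi w.
    by rewrite /chi -big_split /=; apply: eq_bigr => v _; rewrite ffunE.
  have chi_dl v : chi (dl v) = (v \in C)%:R.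
    rewrite /chi; have [vC|vC] := boolP (v \in C).
      rewrite (bigD1 v) //= ffunE inE eqxx big1 ?addr0 // => w /andP[_ wv].
      by rewrite ffunE inE (negPf wv).
    rewrite big1 // => w wC; rewrite ffunE inE.
    by case: eqP wC vC => // -> ->.
  have chiK w : w \in K -> chi w = 0.
    move=> wK; apply/eqP; rewrite -[_ == _]/(w \in [pred w | chi w == 0]).
    apply: sub_F2span wK => [|x xX].
      split; first by rewrite inE /chi big1 // => v _; rewrite ffunE.
      by move=> u v; rewrite !inE chiD => /eqP-> /eqP->; rewrite addr0.
    have [u [v [_ xE]]] := end_ x (subsetP XM x xX).
    have uvK : dl u + dl v \in K by rewrite -xE; apply: mem_F2span.
    rewrite inE xE chiD !chi_dl !in_set.
    have -> : (dl u + dl i \in K) = (dl v + dl i \in K).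
      apply/idP/idP; first by apply: closed_trans; rewrite // addrC.
      exact: closed_trans.
    by case: (_ \in K); rewrite ?addr0 //; apply/eqP.
  have iC : i \in C by rewrite in_set addv2; case: cK.
  have jC : j \notin C by rewrite in_set addrC -aij.
  have outC z : z \in ground M -> (forall k l, phi z = dl k + dl l ->
      dl k + dl i \notin K) -> chi (phi z) = 0.
    move=> /end_[u [v [_ zE]]] zk; rewrite zE chiD !chi_dl !in_set.
    by rewrite (negPf (zk u v zE)) (negPf (zk v u _)) ?addr0 // addrC.
  have pick z : z \in ground M -> chi (phi z) != 0 ->
      exists k l, phi z = dl k + dl l /\ dl k + dl i \in K.
    move=> zM; have [u [v [_ zE]]] := end_ z zM.
    rewrite {1}zE chiD !chi_dl !in_set.
    have [uK|_] := boolP (dl u + dl i \in K); first by exists u, v.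
    have [vK|_] := boolP (dl v + dl i \in K); last by rewrite addr0 eqxx.
    by exists v, u; split=> //; rewrite addrC.
  have sum0 := chiK _ sK.
  rewrite !chiD {1}aij chiD !chi_dl iC (negPf jC) addr0 in sum0.
  have [b0|/(pick b bM)[k [l [bE kK]]]] := eqVneq (chi (phi b)) 0; last first.
    by exists b, k, l; split=> //; apply: Or31.
  have [c0|/(pick c cM)[k [l [cE kK]]]] := eqVneq (chi (phi c)) 0; last first.
    by exists c, k, l; split=> //; apply: Or32.
  have [d0|/(pick d dM)[k [l [dE kK]]]] := eqVneq (chi (phi d)) 0; last first.
    by exists d, k, l; split=> //; apply: Or33.
  by move/eqP: sum0; rewrite b0 c0 d0 !addr0 oner_eq0.
have chord i j z k l : phi a = dl i + dl j -> phi z = dl k + dl l ->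
    dl k + dl i \in K -> phi a + phi z \notin K ->
    exists2 x, x \in ground M & phi a + phi z + phi x \in K.
  move=> aE zE kiK azK; have [lj|lj] := eqVneq l j.
    case/negP: azK; apply: mem_eq kiK _.
    by rewrite aE zE lj; char2.
  have [x xM xE] := mkE l j lj; exists x => //; apply: mem_eq kiK _.
  by rewrite aE zE xE; char2.
have [i [j [ij aij]]] := end_ a aM.
have aji : phi a = dl j + dl i by rewrite addrC.
have [z [k [l [zs zE kiK]]]] := key i j aij.
have [z' [k' [l' [zs' zE' kjK]]]] := key j i aji.
have fin y p q s t : phi a = dl p + dl q -> phi y = dl s + dl t ->
    dl s + dl p \in K -> y = b \/ y = c ->
    exists2 x, x \in ground M &
      (phi a + phi b + phi x \in K) || (phi a + phi c + phi x \in K).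
  move=> aE yE spK [] yb; subst y.
    by have [x xM xK] := chord _ _ _ _ _ aE yE spK abK; exists x; rewrite ?xK.
  by have [x xM xK] := chord _ _ _ _ _ aE yE spK acK; exists x; rewrite ?xK ?orbT.
case: zs => zb.
- by apply: (fin z i j k l) => //; left.
- by apply: (fin z i j k l) => //; right.
case: zs' => zb'.
- by apply: (fin z' j i k' l') => //; left.
- by apply: (fin z' j i k' l') => //; right.
(* Both ends of [a] are now matched with ends of [d]. If it is the same end, [i] and [j] are
   equivalent and [a] is in [K]; if not, [a + d] is in [K]. *)
exfalso; subst z z'.
have kl : k != l by apply: contraNneq dK => kl; rewrite zE kl addv2; case: cK.
have kl' : k' != l' by apply: contraNneq dK => kl'; rewrite zE' kl' addv2; case: cK.
have : [set k; l] = [set k'; l'].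
  by apply: edge_vec_inj; rewrite !edge_vec2 // -/(dl _) -zE.
move/setP/(_ k'); rewrite !inE eqxx /= => /orP[] /eqP kk.
  case/negP: aK; rewrite aij; apply: mem_eq (closedD cK kiK kjK) _.
  by rewrite kk; char2.
case/negP: adK; rewrite aij zE; apply: mem_eq (closedD cK kiK kjK) _.
by rewrite kk; char2.
Qed.

Theorem theorem1p4 (T : finType) (M : matroid T)
    (connM : connected_matroid M) (simpM : simple_matroid M)
    (binM : binary_matroid M) :
  (~ has_induced_minor M (cycle_matroid C4) /\
   ~ has_induced_minor M (cycle_matroid K4_minus_edge))
  <->
  [\/ exists n : nat, isomorphic M (binary_pg n),
      exists (n : nat) (p : 'rV['F_2]_n),
        p \in ground (binary_pg n) /\
        isomorphic M (delete (binary_pg n) [set p])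
    | exists n : nat, isomorphic M (cycle_matroid (complete_graph n))].
Proof.
have rep0 (W : lmodType 'F_2) (U : finType) (phi : T -> W) (psi : U -> W) :
    represents M phi (F2span psi set0) -> represents M phi (F2span phi set0).
  by apply: represents_eq => w; rewrite !F2span0.
split=> [[nC4 nK4]|].
  have [m [n [A isoM]]] := binM.
  have rA := rep_vector [set: 'I_n] (fun j => col j A).
  have [phi [/rep0 rM _ _ _]] := isomorphic_rep (F2span_closed _ _) isoM rA.
  have chM := no_minor_has_chords rM nC4 nK4.
  have injM := simple_inj rM simpM.
  have [[V cV ME]|[V [p [cV pV p0 ME]]]|[D fD ME]] :=
    chordal_structure (image_neq0 rM simpM) (image_chordal rM simpM chM)
      (image_connected rM simpM connM).
  - by apply: Or31; apply: isomorphic_pg cV ME.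
  - by apply: Or32; apply: isomorphic_pg_delete cV pV p0 ME.
  - by apply: Or33; apply: isomorphic_complete fD ME.
case=> [[n isoM]|[n [p [pn isoM]]]|[n isoM]].
- have rN := rep_vector [set p : 'rV['F_2]_n | p != 0] (@id 'rV['F_2]_n).
  have [phi [/rep0 rM _ MN NM]] := isomorphic_rep (F2span_closed _ _) isoM rN.
  apply/(has_chords_no_minor rM)/(pg_has_chords (p := 0)) => x y _ _ xy _.
  have [|z zM zE] := NM (phi x + phi y); first by rewrite inE.
  by exists z.
- have rN : represents (delete (binary_pg n) [set p]) id (F2span id set0).
    exact/rep_restrict/rep_vector.
  have [phi [/rep0 rM _ MN NM]] := isomorphic_rep (F2span_closed _ _) isoM rN.
  apply/(has_chords_no_minor rM)/(pg_has_chords (p := p)) => x y _ _ xy xyp.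
  have [|z zM zE] := NM (phi x + phi y); first by rewrite !inE xy.
  by exists z.
have rN := rep_edge_vec (complete_graph n).
have [phi [/rep0 rM _ MN NM]] := isomorphic_rep (F2span_closed _ _) isoM rN.
by apply: (has_chords_no_minor rM); apply: complete_has_chords MN NM.
Qed.
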